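(* Let $G$ be an infinitely edge-connected graph and let $u,v$ be two distinct vertices of $G$. Then at least one of the following holds: (i) $G$ contains a $T_{\aleph_0}*t$ minor; (ii) $G$ contains a plow minor connecting $u$ and $v$.
   Context: Graphs are simple and may be infinite. A graph is infinitely edge-connected if no two distinct vertices can be separated by deleting finitely many edges. $H$ is a minor of $G$ if there are disjoint non-empty vertex sets $V_h\subseteq V(G)$ (branch sets, $h\in V(H)$), each inducing a connected subgraph, with a $V_h$–$V_{h'}$ edge whenever $hh'\in E(H)$. $T_{\aleph_0}$ is the tree with every vertex of countably infinite degree; $T_{\aleph_0}*t$ is obtained by adding a vertex $t$ adjacent to all its vertices. A half-plow with endvertices $a,b$ is an infinitely edge-connected graph containing the edge $ab$. A plow with endvertices $a,b$ and head $h$ is the union of a half-plow with endvertices $a,h$ and a half-plow with endvertices $h,b$ that share no vertex other than $h$. A plow minor connecting $x$ and $y$ is a plow minor with endvertices $a,b$ such that the branch set of $a$ contains $x$ and that of $b$ contains $y$, or vice versa. *)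

(* Defs.v *)
From Stdlib Require Import Relation_Operators.
From mathcomp Require Import all_boot.
From mathcomp Require Import boolp classical_sets functions cardinality.

Set Implicit Arguments.
Unset Strict Implicit.
Unset Printing Implicit Defensive.

Local Open Scope classical_set_scope.
Local Open Scope card_scope.
Local Obligation Tactic := idtac.

(* The vertices form a subset of the carrier [T], so that subgraphs and unions
   of graphs are again graphs on the same carrier. *)
Record sgraph (T : Type) := SGraph {
  vset : set T;
  adj : T -> T -> Prop;
  adj_sym : forall x y, adj x y -> adj y x;
  adj_irrefl : forall x, ~ adj x x;
  adj_vset : forall x y, adj x y -> vset x }.

Section Graphs.
Context {T : Type}.
Implicit Types G H P : sgraph T.

Definition edges G : set (set T) :=
  [set e | exists x y, adj G x y /\ e = [set x; y]].

Definition neighbours G (x : T) : set T := [set y | adj G x y].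

Program Definition induced G (A : set T) : sgraph T :=
  {| vset := vset G `&` A;
     adj := fun x y => [/\ adj G x y, A x & A y] |}.
Next Obligation. by move=> G A x y /= [Gxy Ax Ay]; split=> //; exact: adj_sym. Qed.
Next Obligation. by move=> G A x /= [Gxx _ _]; exact: adj_irrefl Gxx. Qed.
Next Obligation. by move=> G A x y /= [Gxy Ax _]; split=> //; exact: adj_vset Gxy. Qed.

Program Definition delete_edges G (F : set (set T)) : sgraph T :=
  {| vset := vset G;
     adj := fun x y => adj G x y /\ ~ F [set x; y] |}.
Next Obligation. by move=> G F x y /= [Gxy Fxy]; split; [exact: adj_sym | rewrite setUC]. Qed.
Next Obligation. by move=> G F x /= [Gxx _]; exact: adj_irrefl Gxx. Qed.
Next Obligation. by move=> G F x y /= [Gxy _]; exact: adj_vset Gxy. Qed.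

Program Definition graph_union G H : sgraph T :=
  {| vset := vset G `|` vset H;
     adj := fun x y => adj G x y \/ adj H x y |}.
Next Obligation. by move=> G H x y /= [] e; [left | right]; exact: adj_sym. Qed.
Next Obligation. by move=> G H x /= [] e; exact: adj_irrefl e. Qed.
Next Obligation. by move=> G H x y /= [] e; [left | right]; exact: adj_vset e. Qed.

Definition joined G : T -> T -> Prop := clos_refl_trans T (adj G).

(* The empty graph counts as connected here; nonemptiness is required
   separately wherever it matters. *)
Definition connected G : Prop :=
  forall x y, vset G x -> vset G y -> joined G x y.

Definition infinitely_edge_connected G : Prop :=
  forall x y, vset G x -> vset G y -> x <> y ->
  forall F, finite_set F -> F `<=` edges G -> joined (delete_edges G F) x y.

Definition acyclic G : Prop :=
  ~ exists (n : nat) (c : 'I_n -> T),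
      [/\ 2 < n, injective c & forall i, adj G (c i) (c (ordS i))].

Definition tree G : Prop := [/\ vset G !=set0, connected G & acyclic G].

Definition T_aleph0 G : Prop :=
  tree G /\ forall x, vset G x -> neighbours G x #= [set: nat].

(* [None] is the added vertex t of G * t. *)
Definition cone_vset G : set (option T) :=
  fun o => if o is Some x then vset G x else True.

Definition cone_adj G (o p : option T) : Prop :=
  match o, p with
  | Some x, Some y => adj G x y
  | Some x, None | None, Some x => vset G x
  | None, None => False
  end.

Program Definition cone G : sgraph (option T) :=
  {| vset := cone_vset G; adj := cone_adj G |}.
Next Obligation. by move=> G [x|] [y|] //=; apply: adj_sym. Qed.
Next Obligation. by move=> G [x|] //=; apply: adj_irrefl. Qed.
Next Obligation. by move=> G [x|] [y|] //=; apply: adj_vset. Qed.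

Definition half_plow H (a b : T) : Prop :=
  infinitely_edge_connected H /\ adj H a b.

Definition plow P (a b h : T) : Prop :=
  exists H1 H2 : sgraph T,
    [/\ half_plow H1 a h, half_plow H2 h b,
        vset H1 `&` vset H2 = [set h] & P = graph_union H1 H2].

End Graphs.

(* Only the values of [B] on the vertices of [H] are relevant. *)
Definition branch_sets {S T : Type} (H : sgraph S) (G : sgraph T)
    (B : S -> set T) : Prop :=
  [/\ forall h, vset H h ->
        [/\ B h `<=` vset G, B h !=set0 & connected (induced G (B h))],
      trivIset (vset H) B
    & forall h h', adj H h h' ->
        exists x y, [/\ B h x, B h' y & adj G x y]].

Definition minor {S T : Type} (H : sgraph S) (G : sgraph T) : Prop :=
  exists B : S -> set T, branch_sets H G B.

Definition has_T_aleph0_star_t_minor {T : Type} (G : sgraph T) : Prop :=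
  exists (S : Type) (K : sgraph S), T_aleph0 K /\ minor (cone K) G.

Definition has_plow_minor_connecting {T : Type} (G : sgraph T) (x y : T) : Prop :=
  exists (S : Type) (P : sgraph S) (a b h : S) (B : S -> set T),
    [/\ plow P a b h, branch_sets P G B
      & (B a x /\ B b y) \/ (B a y /\ B b x)].

(* Main.v *)
From Stdlib Require List.
From Stdlib Require Import Relation_Operators.
Require Import Defs.
From mathcomp Require Import all_boot finmap.
From mathcomp Require Import boolp classical_sets functions cardinality.

(* Let C(W, u, v) say that G[W] is infinitely edge-connected, contains u and v,
   and has no plow minor connecting them. A triple (W, u, v) splits at u if there
   are disjoint connected sets U, V containing u and v, and infinitely many
   disjoint sets N_i outside both, each adjacent to V and infinitely
   edge-connected together with some x_i in U. With n_i in N_i adjacent to V,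
   each (N_i + x_i, x_i, n_i) satisfies C again. Iterating splits at the
   same end yields a T_aleph0 * t minor: the sets V are the tree vertices and the
   sets U together form t. A split at v of which some child splits at u gives a
   split at u, so it suffices to show that C(W, u, v) implies a split at u or at
   v, or else a K_aleph0 minor.

   For a maximal infinitely edge-connected K in W - v containing u, the complement
   W - K is infinitely edge-connected as well; an edge between K and W - K which
   avoids u and v would give a plow with that edge contracted to the head, so one
   may assume that W - v is infinitely edge-connected. If no infinitely
   edge-connected subset of M = W - u - v has infinitely many neighbours of v, then
   contracting the maximal ones and repeatedly cutting off parts of M leads to a
   split at u or to K_aleph0. Otherwise one finds N such that N, N + u, N + v are
   all infinitely edge-connected. If a finite S in N finitely separates a neighbour
   of u from a neighbour of v in N - S, a smallest such S contains the head of a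
   plow; if there is no such S then N has a K_aleph0 minor. *)

Set Implicit Arguments.
Unset Strict Implicit.
Unset Printing Implicit Defensive.

Local Open Scope classical_set_scope.

(** * Finite sets and infinite sequences *)

Lemma finite_set_ind (T : Type) (Pr : set T -> Prop) :
  Pr set0 ->
  (forall x A, finite_set A -> ~ A x -> Pr A -> Pr (x |` A)) ->
  forall A, finite_set A -> Pr A.
Proof.
move=> P0 PU A; elim/Pchoice: T => T in Pr P0 PU A *.
move=> /finite_seqP[s ->{A}]; elim: s => [|x s IHs]; first by rewrite set_nil.
case: (boolP (x \in s)) => xs.
  suff -> : [set` x :: s] = [set` s] by [].
  rewrite predeqE => y /=; rewrite inE; split=> [/orP[/eqP->|]|->] //.
  by rewrite orbT.
have -> : [set` x :: s] = x |` [set` s].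
  rewrite predeqE => y /=; rewrite inE; split=> [/orP[/eqP|]|[/= ->|/= ->]].
  - by left.
  - by right.
  - by rewrite eqxx.
  - by rewrite orbT.
by apply: PU => //; exact/negP.
Qed.

Lemma infinite_meets (T : Type) (A B : set T) :
  infinite_set A -> finite_set B -> exists x, A x /\ ~ B x.
Proof.
by move=> iA fB; have /infinite_setN0[x [Ax Bx]] := infinite_setD iA fB; exists x.
Qed.

Lemma finite_setU2 (T : Type) (A B : set T) :
  finite_set A -> finite_set B -> finite_set (A `|` B).
Proof. by rewrite finite_setU. Qed.

Lemma dependent_chain (X : Type) (R : X -> X -> Prop) (x0 : X) :
  (forall x, exists y, R x y) ->
  exists f : nat -> X, f 0 = x0 /\ forall n, R (f n) (f n.+1).
Proof.
by move=> /choice[g gP]; exists (fun n => iter n g x0); split.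
Qed.

(* Greedy construction: if every finite list of pairwise [R]-related good
   elements extends, there is an infinite [R]-related sequence. *)
Lemma greedy_sequence (X : Type) (good : X -> Prop) (R : X -> X -> Prop) :
  (forall l : seq X, List.Forall good l -> List.ForallOrdPairs R l ->
     exists x, good x /\ List.Forall (R x) l) ->
  exists f : nat -> X, (forall n, good (f n)) /\
    forall m n, m < n -> R (f n) (f m).
Proof.
move=> ext.
pose ok l := List.Forall good l /\ List.ForallOrdPairs R l.
have step (l : {l | ok l}) :
    exists l' : {l | ok l}, exists x, sval l' = x :: sval l.
  case: l => l [gl Rl]; have [x [gx Rx]] := ext l gl Rl.
  have okxl : ok (x :: l) by split; constructor.
  by exists (exist _ _ okxl), x.
have ok0 : ok [::] by split; constructor.
have [F [F0 FS]] := dependent_chain (exist _ _ ok0) step.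
have [f fP] := choice FS; exists f.
have gF n : List.Forall good (sval (F n)) by case: (F n) => l [].
have RF n : List.ForallOrdPairs R (sval (F n)) by case: (F n) => l [].
split=> [n|m n mn].
  by have := gF n.+1; rewrite fP => H; inversion H.
have inF k : List.In (f m) (sval (F (m.+1 + k))).
  elim: k => [|k IHk]; first by rewrite addn0 fP; left.
  by rewrite addnS fP; right.
have := RF n.+1; rewrite fP => H; inversion H as [|a l Ha _]; subst.
have := inF (n - m.+1); rewrite subnKC //.
by move: Ha; rewrite List.Forall_forall => /[apply].
Qed.

(** * Cuts and infinitely edge-connected sets *)

Section Cuts.
Context {T : Type} (G : sgraph T).
Implicit Types A B K P Q S X : set T.

Definition cut P Q : set (T * T) :=
  [set e | [/\ P e.1, Q e.2 & adj G e.1 e.2]].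

Definition finite_cut P Q : Prop := finite_set (cut P Q).

Definition conn A : Prop := forall P,
  (exists2 x, A x & P x) -> (exists2 y, A y & ~ P y) ->
  exists x y, [/\ A x, P x, A y, ~ P y & adj G x y].

(* Infinite edge-connectivity of [G[A]], in terms of cuts. *)
Definition iec A : Prop := forall P,
  (exists2 x, A x & P x) -> (exists2 y, A y & ~ P y) ->
  ~ finite_cut (A `&` P) (A `\` P).

(* No finite set of edges of [G[A]] separates a vertex of [A] from [S]. *)
Definition linked A S : Prop := forall P,
  (exists2 x, A x & P x) -> (forall x, A x -> P x -> ~ S x) ->
  ~ finite_cut (A `&` P) (A `\` P).

Lemma finite_cutS P Q P' Q' :
  (forall x y, P x -> Q y -> adj G x y -> P' x /\ Q' y) ->
  finite_cut P' Q' -> finite_cut P Q.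
Proof.
by move=> sub; apply: sub_finite_set => -[x y] /= [Px Qy Exy]; have [] := sub x y.
Qed.

Lemma finite_cutU P1 Q1 P2 Q2 P Q :
  (forall x y, P x -> Q y -> adj G x y -> (P1 x /\ Q1 y) \/ (P2 x /\ Q2 y)) ->
  finite_cut P1 Q1 -> finite_cut P2 Q2 -> finite_cut P Q.
Proof.
move=> sub f1 f2; have : finite_set (cut P1 Q1 `|` cut P2 Q2).
  by rewrite finite_setU.
by apply: sub_finite_set => -[x y] [/= Px Qy Exy];
  have [] // := sub x y => -[? ?]; [left|right].
Qed.

Lemma finite_cutC P Q : finite_cut P Q -> finite_cut Q P.
Proof.
move=> /(finite_image (fun e => (e.2, e.1))); apply: sub_finite_set.
by move=> [x y] /= [Qx Py Exy]; exists (y, x) => //; split=> //; apply: adj_sym.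
Qed.

Lemma finite_cut0 P Q :
  (forall x y, P x -> Q y -> adj G x y -> False) -> finite_cut P Q.
Proof.
move=> no; apply: (sub_finite_set _ (finite_set0 (T * T))).
by move=> [x y] [/= Px Qy Exy]; apply: (no x y).
Qed.

Lemma finite_cut_point x Q :
  finite_cut [set x] Q <-> finite_set (neighbours G x `&` Q).
Proof.
split=> [/(finite_image snd)|/(finite_image (pair x))]; apply: sub_finite_set.
  by move=> y [/= Exy Qy]; exists (x, y).
by move=> [z y] [/= -> Qy Exy]; exists y.
Qed.

Lemma infinite_cut_ex P Q :
  ~ finite_cut P Q -> exists x y, [/\ P x, Q y & adj G x y].
Proof.
move=> inf; apply: contrapT => no; apply: inf; apply: finite_cut0 => x y Px Qy Exy.
by apply: no; exists x, y.
Qed.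

(** One of the two sides of any cut misses [s], and finiteness of a cut does not depend on the side,
    so only sides without [s] have to be tested. *)
Lemma linked_iec A s : A s -> linked A [set s] -> iec A.
Proof.
move=> As lA P [x Ax Px] [y Ay nPy] fin; have [Ps|nPs] := pselect (P s); last first.
  by apply: (lA P _ _ fin); [exists x | move=> z Az Pz /= zs; subst].
apply: (lA (~` P)); first by exists y.
  by move=> z Az nPz /= zs; subst.
apply: finite_cutS (finite_cutC fin) => z w [Az nPz] [Aw nnPw] _.
by split; split=> //; apply: contrapT.
Qed.

Lemma iec_linked A S s : iec A -> A s -> S s -> linked A S.
Proof.
move=> iA As Ss P ex nS; apply: iA => //; exists s => // Ps.
exact: nS As Ps Ss.
Qed.

Lemma linkedS A S S' : linked A S -> (forall x, A x -> S x -> S' x) -> linked A S'.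
Proof.
by move=> lA sub P ex nS; apply: lA => // x Ax Px Sx; apply: nS (Ax) Px _; apply: sub.
Qed.

Lemma iec1 s : iec [set s].
Proof. by move=> P [x /= -> Ps] [y /= ->]. Qed.

Lemma iec_conn A : iec A -> conn A.
Proof.
move=> iA P ex ey; have [x [y [[Ax Px] [Ay nPy] Exy]]] := infinite_cut_ex (iA P ex ey).
by exists x, y.
Qed.

Lemma conn1 s : conn [set s].
Proof. by move=> P [x /= -> Ps] [y /= ->]. Qed.

(** [s] lies on one side of the cut; a member meeting the other side is itself divided and already
    contributes infinitely many edges. *)
Lemma iec_bigU (F : set (set T)) s :
  (forall A, F A -> iec A /\ A s) -> iec (\bigcup_(A in F) A).
Proof.
move=> FP P [x [A FA Ax] Px] [y [B FB By] nPy] fin.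
have [iA As] := FP A FA; have [iB Bs] := FP B FB.
have [Ps|nPs] := pselect (P s).
  apply: (iB P); [by exists s | by exists y |].
  by apply: finite_cutS fin => z w [Bz Pz] [Bw nPw] _; split; split=> //; exists B.
apply: (iA P); [by exists x | by exists s |].
by apply: finite_cutS fin => z w [Az Pz] [Aw nPw] _; split; split=> //; exists A.
Qed.

Lemma conn_bigU I (D : set I) (F : I -> set T) s :
  (forall i, D i -> conn (F i) /\ F i s) -> conn (\bigcup_(i in D) F i).
Proof.
move=> FP P [x [i Di Fx] Px] [y [j Dj Fy] nPy].
have [ci Fis] := FP i Di; have [cj Fjs] := FP j Dj.
have [Ps|nPs] := pselect (P s).
  have [||a [b [Fa Pa Fb nPb Eab]]] := cj P; [by exists s | by exists y |].
  by exists a, b; split=> //; exists j.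
have [||a [b [Fa Pa Fb nPb Eab]]] := ci P; [by exists x | by exists s |].
by exists a, b; split=> //; exists i.
Qed.

Lemma iecU A B : iec A -> iec B -> (exists2 s, A s & B s) -> iec (A `|` B).
Proof.
move=> iA iB [s As Bs].
have -> : A `|` B = \bigcup_(X in [set A; B]) X.
  rewrite predeqE => x; split=> [[]|[X /= [] ->]]; [| |by left|by right].
  - by exists A => //; left.
  - by exists B => //; right.
by apply: (@iec_bigU _ s) => X [] /= ->.
Qed.

Lemma connU A B : conn A -> conn B ->
  (exists s t, [/\ A s, B t & s = t \/ adj G s t]) -> conn (A `|` B).
Proof.
move=> cA cB [s [t [As Bt st]]] P [x ABx Px] [y ABy nPy].
have goA : (exists2 x, A x & P x) -> (exists2 y, A y & ~ P y) ->
    exists x y, [/\ (A `|` B) x, P x, (A `|` B) y, ~ P y & adj G x y].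
  move=> ex ey; have [a [b [Aa Pa Ab nPb Eab]]] := cA P ex ey.
  by exists a, b; split=> //; left.
have goB : (exists2 x, B x & P x) -> (exists2 y, B y & ~ P y) ->
    exists x y, [/\ (A `|` B) x, P x, (A `|` B) y, ~ P y & adj G x y].
  move=> ex ey; have [a [b [Ba Pa Bb nPb Eab]]] := cB P ex ey.
  by exists a, b; split=> //; right.
have [Ps|nPs] := pselect (P s); have [Pt|nPt] := pselect (P t).
- by case: ABy => ?; [apply: goA; [exists s|exists y]|apply: goB; [exists t|exists y]].
- case: st => [st|Est]; first by subst.
  by exists s, t; split=> //; [left|right].
- case: st => [st|Est]; first by subst.
  by exists t, s; split=> //; [right|left|exact: adj_sym].
- by case: ABx => ?; [apply: goA; [exists x|exists s]|apply: goB; [exists x|exists t]].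
Qed.

(** A finite cut divides neither [A] nor [B], so it could only separate them from each other and
    would contain all edges between them. *)
Lemma iecU_cut A B : iec A -> iec B -> ~ finite_cut A B -> iec (A `|` B).
Proof.
move=> iA iB inf P [x ABx Px] [y ABy nPy] fin.
have dich C : iec C -> C `<=` A `|` B -> C `<=` P \/ C `<=` ~` P.
  move=> iC sub; apply: contrapT => /not_orP[/existsNP[c /not_implyP[Cc nPc]]].
  move=> /existsNP[d /not_implyP[Cd /contrapT Pd]].
  apply: (iC P); [by exists d | by exists c |].
  by apply: finite_cutS fin => z w [Cz Pz] [Cw nPw] _; split; split=> //; apply: sub.
have [AP|AP] := dich A iA (@subsetUl _ _ _);
  have [BP|BP] := dich B iB (@subsetUr _ _ _).
- by case: ABy => [/AP|/BP].
- apply: inf; apply: finite_cutS fin => z w Az Bw _.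
  by split; split; [left|exact: AP|right|exact: BP].
- apply: inf; apply: finite_cutC; apply: finite_cutS fin => z w Bz Aw _.
  by split; split; [right|exact: BP|left|exact: AP].
- by case: ABx => [/AP|/BP].
Qed.

(** The largest infinitely edge-connected subset of [B] containing [k]; empty when [k] is not in
    [B]. *)
Definition iec_hull B k : set T :=
  \bigcup_(A in [set A | [/\ iec A, A `<=` B & A k]]) A.

Lemma iec_hull_iec B k : iec (iec_hull B k).
Proof. by apply: (@iec_bigU _ k) => A []. Qed.

Lemma iec_hull_sub B k : iec_hull B k `<=` B.
Proof. by move=> x [A [_ AB _]]; exact: AB. Qed.

Lemma iec_hull_self B k : B k -> iec_hull B k k.
Proof.
by move=> Bk; exists [set k] => //; split=> //; [exact: iec1 | move=> x /= ->].
Qed.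

Lemma iec_hull_max B k A : iec A -> A `<=` B -> A k -> A `<=` iec_hull B k.
Proof. by move=> iA AB Ak x Ax; exists A. Qed.

(* Whatever is separated from [S] outside [K] by finitely many edges is
   inseparable from [K], and would enlarge [K]. *)
Lemma linkedD A S K :
  K !=set0 -> iec K -> K `<=` A `\` S ->
  (forall K', iec K' -> K `<=` K' -> K' `<=` A `\` S -> K' `<=` K) ->
  linked A (S `|` K) -> linked (A `\` K) S.
Proof.
move=> [k Kk] iK KAS max lA P [x [Ax nKx] Px] PS fin.
pose P' : set T := (A `\` K) `&` P.
suff iKP : iec (K `|` P').
  apply: (nKx); have K'K : K `|` P' `<=` K; last by apply: K'K; right.
  apply: (max _ iKP (@subsetUl _ K P')).
  by move=> z [/KAS//|[[Az nKz] Pz]]; split=> // Sz; apply: (PS z) Sz.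
apply: (@linked_iec _ k); first by left.
move=> Q [y KPy Qy] nQk fin'.
have Kk' z : K z -> ~ Q z.
  move=> Kz Qz; apply: (iK Q); [by exists z | exists k => //|].
    by move=> Qk; apply: (nQk k) => //; left.
  by apply: finite_cutS fin' => a b [Ka Qa] [Kb nQb] _; split; split=> //; left.
(* Edges of [A] leaving the part of [P'] inside [Q] end either in the rest of [K] plus [P'], where
   [fin'] bounds them, or outside [K] and [P], where [fin] does. *)
apply: (lA (P' `&` Q)).
- case: KPy => [/Kk'//|P'y]; by exists y => //; case: P'y => [[]].
- by move=> z Az [[[_ nKz] Pz] Qz] [Sz|//]; apply: (PS z) Sz.
apply: finite_cutU fin' fin => a b [Aa [P'a Qa]] [Ab nb] _.
have [Kb|nKb] := pselect (K b).
  by left; split; split=> //; [right|left|exact: Kk'].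
have [Pb|nPb] := pselect (P b); last by right; split; [case: P'a|].
left; split; split=> //; [by right|by right|move=> Qb].
by apply: nb.
Qed.

Definition component A s : set T :=
  \bigcup_(B in [set B | [/\ conn B, B `<=` A & B s]]) B.

Lemma component_conn A s : conn (component A s).
Proof. by apply: (@conn_bigU _ _ _ s) => B []. Qed.

Lemma component_sub A s x : component A s x -> A x.
Proof. by move=> [B [_ BA _]]; exact: BA. Qed.

Lemma component_self A s : A s -> component A s s.
Proof.
by move=> As; exists [set s] => //; split=> //; [exact: conn1|move=> x /= ->].
Qed.

Lemma component_closed A s x y : component A s x -> A y -> adj G x y -> component A s y.
Proof.
move=> [B [cB BA Bs] Bx] Ay Exy; exists (B `|` [set y]); last by right.
split; [|by move=> z [/BA|/= ->]|by left].
by apply: (connU cB (@conn1 y)); exists x, y; split=> //; right.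
Qed.

(** The vertices reached from [x] by finite connected sets have no edge leaving them inside [A].
    Such sets take the place of paths. *)
Lemma conn_finite_link A x y : conn A -> A x -> A y ->
  exists R, [/\ finite_set R, conn R, R `<=` A, R x & R y].
Proof.
move=> cA Ax Ay; apply: contrapT => no.
pose P z := exists R, [/\ finite_set R, conn R, R `<=` A, R x & R z].
have Px : P x.
  exists [set x]; split=> //; [exact: conn1|by move=> z /= ->].
have [||a [b [Aa [R [fR cR RA Rx Ra]] Ab nPb Eab]]] := cA P; [by exists x|by exists y|].
apply: nPb; exists (R `|` [set b]); split; [|by apply: connU => //;
  [exact: conn1|exists a, b; split=> //; right]|by move=> z [/RA|/= ->]|by left|by right].
by rewrite finite_setU; split=> //; exact: finite_set1.
Qed.

(** [R] acts as the segment of a path before its first vertex in [Y]: an edge of [A] leaving the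
    component of [x] in [A] minus [Y] must enter [Y]. *)
Lemma conn_exit A Y x : conn A -> A x -> ~ Y x -> (exists2 y, A y & Y y) ->
  exists R, [/\ finite_set R, conn R, R `<=` A `\` Y, R x
    & exists r y, [/\ R r, A y, Y y & adj G r y]].
Proof.
move=> cA Ax nYx [y Ay Yy]; have Dx : (A `\` Y) x by [].
have [||a [b [Aa Ca Ab nCb Eab]]] := cA (component (A `\` Y) x).
- by exists x => //; apply: component_self.
- by exists y => // /component_sub[].
have Yb : Y b.
  by apply: contrapT => nYb; apply: nCb; apply: component_closed Ca _ Eab.
have [R [fR cR RC Rx Ra]] :=
  conn_finite_link (@component_conn _ _) (component_self Dx) Ca.
exists R; split=> //; first by move=> z /RC /component_sub.
by exists a, b.
Qed.

Lemma conn_reach A Y x : conn A -> A x -> (exists2 y, A y & Y y) ->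
  exists R, [/\ finite_set R, conn R, R `<=` A, R x
    & exists y, [/\ R y, Y y & forall z, R z -> Y z -> z = y]].
Proof.
move=> cA Ax eY; have [Yx|nYx] := pselect (Y x).
  exists [set x]; split=> //; [exact: conn1|by move=> z /= ->|].
  by exists x.
have [R [fR cR RA Rx [r [y [Rr Ay Yy Ery]]]]] := conn_exit cA Ax nYx eY.
exists (R `|` [set y]); split; [|by apply: connU => //; [exact: conn1|exists r, y;
  split=> //; right]| |by left|].
- by rewrite finite_setU; split=> //; exact: finite_set1.
- by move=> z [/RA[]|/= ->].
- by exists y; split=> //; [right|move=> z [/RA[]|]].
Qed.

Lemma iec_infinite_neighbours A s : iec A -> A s -> (exists2 x, A x & x <> s) ->
  infinite_set (neighbours G s `&` A).
Proof.
move=> iA As [x Ax xs] fin; apply: (iA [set s]); [by exists s|by exists x|].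
have /finite_cut_point := fin; apply: finite_cutS => z w [Az /= ->] [Aw _] _.
by split.
Qed.

End Cuts.

Lemma finite_minimal (T : Type) (Pr : set T -> Prop) S :
  finite_set S -> Pr S ->
  exists S', [/\ S' `<=` S, Pr S' & forall s, S' s -> ~ Pr (S' `\ s)].
Proof.
elim/Pchoice: T => T in Pr S *.
move=> /finite_fsetP[X ->{S}]; have [n] := ubnP (#|` X|).
elim: n X => // n IHn X ltXn PX.
have [[s Xs Ps]|no] := pselect (exists2 s, s \in X & Pr ([set` X] `\ s)); last first.
  by exists [set` X]; split=> // s Xs Ps; apply: no; exists s.
have E : [set` X] `\ s = [set` (X `\ s)%fset].
  rewrite predeqE => z /=; rewrite in_fsetD1; split=> [[Xz /eqP zs]|/andP[/eqP zs Xz]] //.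
  by rewrite zs.
move: Ps; rewrite E => /IHn[|S' [S'X PS' mS']].
  by move: ltXn; rewrite (cardfsD1 s) Xs.
exists S'; split=> //; rewrite -E in S'X.
by move=> z /S'X[].
Qed.

(** * Plows *)

Section Plows.
Context {T : Type} (G : sgraph T).
Implicit Types A B K P Q S X W : set T.

(* [A1] and [A2] become the two half-plows, and the head is [k = l] or the
   contracted edge [kl]. *)
Record plow_config W (u v : T) A1 A2 (U V : set T) (k l a b : T) : Prop :=
  PlowConfig {
    pc_iec1 : iec G A1; pc_iec2 : iec G A2;
    pc_sub : A1 `|` A2 `|` U `|` V `<=` W;
    pc_k : A1 k; pc_a : A1 a; pc_ak : a <> k;
    pc_l : A2 l; pc_b : A2 b; pc_bl : b <> l;
    pc_meet : forall x, A1 x -> A2 x -> x = k /\ x = l;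
    pc_head : k = l \/ adj G k l;
    pc_connU : conn G U; pc_Uu : U u; pc_Ua : U a;
    pc_connV : conn G V; pc_Vv : V v; pc_Vb : V b;
    pc_UV : forall x, U x -> V x -> False;
    pc_U : forall x, U x -> A1 x \/ A2 x -> x = a;
    pc_V : forall x, V x -> A1 x \/ A2 x -> x = b }.

Definition set_plow W u v : Prop :=
  exists A1 A2 U V k l a b, plow_config W u v A1 A2 U V k l a b.

Lemma set_plowS W W' u v : W `<=` W' -> set_plow W u v -> set_plow W' u v.
Proof.
move=> WW' [A1 [A2 [U [V [k [l [a [b H]]]]]]]].
exists A1, A2, U, V, k, l, a, b; case: H => *; constructor=> //.
by apply: subset_trans WW'.
Qed.

Lemma set_plowC W u v : set_plow W u v -> set_plow W v u.
Proof.
move=> [A1 [A2 [U [V [k [l [a [b H]]]]]]]].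
exists A2, A1, V, U, l, k, b, a;
  case: H => i1 i2 sb k1 a1 ak l2 b2 bl meet hd cU Uu Ua cV Vv Vb UV hU hV;
  constructor=> //.
- by move=> x H; apply: sb; case: H => [[[]|]|]; [left; left; right|left; left;
    left|right|left; right].
- by move=> x A2x A1x; have [-> ->] := meet x A1x A2x.
- by case: hd => [->|?]; [left|right; exact: adj_sym].
- by move=> x Vx Ux; exact: UV Ux Vx.
- by move=> x Vx Ax; apply: hV => //; case: Ax; [right|left].
- by move=> x Ux Ax; apply: hU => //; case: Ax; [right|left].
Qed.

Lemma plow_of_disjoint C D W u v k l :
  iec G C -> iec G D -> C `<=` W -> D `<=` W ->
  (forall x, C x -> D x -> False) ->
  C u -> C k -> k <> u -> D v -> D l -> l <> v -> adj G k l ->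
  set_plow W u v.
Proof.
move=> iC iD CW DW CD Cu Ck ku Dv Dl lv Ekl.
exists C, D, [set u], [set v], k, l, u, v; constructor=> //.
- by move=> z [[[/CW|/DW]|/= ->]|/= ->] //; [exact: CW|exact: DW].
- by move=> /esym.
- by move=> /esym.
- by move=> x Cx /(CD _ Cx).
- by right.
- exact: conn1.
- exact: conn1.
- by move=> x /= -> uv; apply: (CD u) => //; rewrite uv.
Qed.

(* If every hull were trivial, [linkedD] would remove the elements of [S] one at
   a time and leave [P] linked to the empty set. *)
Lemma hull_meets P S :
  P !=set0 -> finite_set S -> (forall x, P x -> S x -> False) ->
  linked G (P `|` S) S ->
  exists s p, [/\ S s, P p & iec_hull G (P `|` [set s]) s p].
Proof.
move=> [p0 Pp0] fS; move: S fS; apply: finite_set_ind => [_ lP|x S fS nSx IH PS lP].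
  exfalso; apply: (lP setT); [by exists p0 => //; left|by move=> ? _ _ []|].
  by apply: finite_cut0 => a b _ [_ /(_ I)].
have [[p Pp Kp]|no] := pselect (exists2 p, P p & iec_hull G (P `|` [set x]) x p).
  by exists x, p; split=> //; left.
have [||s [p [Ss Pp Kp]]] := IH.
- by move=> z Pz Sz; apply: (PS z) => //; right.
- have -> : P `|` S = (P `|` (x |` S)) `\` [set x].
    rewrite predeqE => z; split=> [[Pz|Sz]|[[Pz|[|Sz]]] // nzx]; [| |by left|by right].
      by split; [left|move=> /= zx; apply: (PS z) => //; left].
    by split; [right; right|move=> /= zx; apply: nSx; rewrite -zx].
  apply: linkedD.
  + by exists x.
  + exact: iec1.
  + by move=> z /= ->; split=> //; right; left.
  + move=> K' iK' xK' K'sub z K'z; apply: contrapT => /= zx; apply: no; exists z.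
      by case: (K'sub _ K'z) => [[//|[//|Sz]]].
    apply: (iec_hull_max iK') => //; last by apply: xK'.
    by move=> w /K'sub[[Pw|[->|//]]] ?; [left|right].
  + by apply: linkedS lP _ => z _ [->|Sz]; [right|left].
by exists s, p; split=> //; right.
Qed.

Section Separator.
Variables (N : set T) (iN : iec G N).

(** A part of [P] plus [S] avoiding [S] lies in [P], and its edges leaving [P] plus [S] are among
    the finitely many leaving [P]; a finite cut around it would contradict [iN]. *)
Lemma linked_separator S P :
  P `<=` N `\` S -> S `<=` N -> (exists2 w, N w & ~ (P `|` S) w) ->
  finite_cut G P ((N `\` S) `\` P) -> linked G (P `|` S) S.
Proof.
move=> PN SN [w Nw nw] fP X [x PSx Xx] XS fin.
apply: (iN (P := (P `|` S) `&` X)).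
- by exists x => //; case: PSx => [/PN[]|/SN].
- by exists w => // -[].
apply: finite_cutU fin fP => a b [_ [PSa Xa]] [Nb nb] _.
have [PSb|nPSb] := pselect ((P `|` S) b); first by left; do !split=> //; move=> Xb;
  apply: nb.
right; split; first by case: PSa => // Sa; case: (XS a) => //; right.
by split; [split=> // Sb; apply: nPSb; right|move=> Pb; apply: nPSb; left].
Qed.

(** A minimal finite separator [S] provides the head [s]. One half-plow is a hull of [s] inside the
    side of [y] plus [s], the other is the side of [y'] plus all of [S]; they meet only in [s]. *)
Lemma plow_of_separator W u v y y' S0 :
  N `<=` W -> W u -> W v -> ~ N u -> ~ N v -> u <> v ->
  N y -> N y' -> adj G u y -> adj G v y' ->
  finite_set S0 -> S0 `<=` N `\` [set y; y'] ->
  (exists P, [/\ P y, ~ P y' & finite_cut G ((N `\` S0) `&` P) ((N `\` S0) `\` P)]) ->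
  set_plow W u v.
Proof.
move=> NW Wu Wv nNu nNv uv Ny Ny' Euy Evy' fS0 S0N.
pose sep R := exists P,
  [/\ P y, ~ P y' & finite_cut G ((N `\` R) `&` P) ((N `\` R) `\` P)].
move=> /(finite_minimal (Pr := sep) fS0)[S [SS0 [P0 [P0y nP0y' fP0]] minS]].
have fS : finite_set S by apply: sub_finite_set fS0.
have SN : S `<=` N by move=> z /SS0 /S0N[].
have nSy : ~ S y by move=> /SS0 /S0N[_]; apply; left.
have nSy' : ~ S y' by move=> /SS0 /S0N[_]; apply; right.
pose P := component G ((N `\` S) `&` P0) y; pose Q := component G ((N `\` S) `\` P0) y'.
have Py : P y by apply: component_self.
have Qy' : Q y' by apply: component_self.
have PNS : P `<=` N `\` S by move=> z Pz; have [] := component_sub Pz.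
have QNS : Q `<=` N `\` S by move=> z Qz; have [] := component_sub Qz.
have PQ z : P z -> Q z -> False 
  by move=> Pz Qz; have [_ P0z] := component_sub Pz; have [_] := component_sub Qz.
have fP : finite_cut G P ((N `\` S) `\` P).
  apply: finite_cutS fP0 => a b Pa [NSb nPb] Eab; split; first exact: component_sub Pa.
  by split=> // P0b; apply: nPb; apply: component_closed Pa _ Eab.
have fQ : finite_cut G Q ((N `\` S) `\` Q).
  apply: finite_cutS (finite_cutC fP0) => a b Qa [NSb nQb] Eab.
  split; first exact: component_sub Qa.
  split=> //; apply: contrapT => nP0b; apply: nQb.
  by apply: component_closed Qa _ Eab.
have lP : linked G (P `|` S) S.
  apply: linked_separator => //; exists y' => // -[Py'|//]; exact: PQ Py' Qy'.
have lQ : linked G (Q `|` S) S.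
  apply: linked_separator => //; exists y => // -[Qy|//]; exact: PQ Py Qy.
(* By minimality [y'] cannot be finitely separated from any [s] in [Q + s]. *)
have iQS : iec G (Q `|` S).
  apply: (@linked_iec _ _ _ y'); first by left.
  move=> X eX Xy' fin.
  have [[s Ss Xs]|no] := pselect (exists2 s, S s & X s); last first.
    by apply: lQ fin => // x _ Xx Sx; apply: no; exists x.
  apply: (minS s Ss); exists (~` (Q `\` X)); split.
  - by move=> -[/(PQ _ Py)].
  - by apply; split=> // Xy'x; apply: (Xy' y') => //; left.
  have := finite_cutC fQ; have := finite_cutC fin; move=> /finite_cutC.
  apply: finite_cutU => a b [[Na nSa] QXa] [_ /contrapT[Qb nXb]] _.
  have [as_|nas] := pselect (a = s).
    by left; rewrite as_; do !split=> //; [right|left].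
  have {}nSa : ~ S a by move=> Sa; apply: nSa.
  have [Qa|nQa] := pselect (Q a); last by right.
  left; split; split=> //; [by left| |by left].
  by apply: contrapT => nXa; apply: QXa.
(* [hull_meets] picks an [s] whose hull reaches into [P], so that this half-plow is not a single
   vertex. *)
have [s [p [Ss Pp A1p]]] := hull_meets (ex_intro _ _ Py) fS (fun x Px => (PNS x Px).2) lP.
set A1 := iec_hull G (P `|` [set s]) s in A1p.
have A1sub : A1 `<=` P `|` [set s] by exact: iec_hull_sub.
have nPs : ~ P s by move=> /PNS[].
have nQs : ~ Q s by move=> /QNS[].
(* [R] leads from [y] to its first vertex [a] in [A1]; with [u] added it connects [u] to [a], while
   [y'] is already adjacent to [v]. *)
have [|R [fR cR RP Ry [a [Ra A1a uniq_a]]]] :=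
  conn_reach (@component_conn _ G _ y) Py (Y := A1).
  by exists p.
have meet x : A1 x -> (Q `|` S) x -> x = s.
  by move=> /A1sub[Px [/(PQ _ Px)//|Sx]|//]; case: (PNS x Px).
exists A1, (Q `|` S), (R `|` [set u]), [set y'; v], s, s, a, y'; constructor=> //.
- exact: iec_hull_iec.
- move=> z [[[/A1sub[/PNS[/NW]|/= ->]|[/QNS[/NW]|/SN/NW]]|[/RP/PNS[/NW]|/= ->]]|[/=
    ->|/= ->]] //.
    by apply/NW/SN.
  exact: NW.
- exact: iec_hull_self (or_intror _).
- by move=> as_; apply: nPs; rewrite -as_; exact: RP.
- by right.
- by left.
- by move=> y's; apply: nSy'; rewrite y's.
- by move=> x A1x QSx; rewrite (meet x).
- by left.
- by apply: connU => //; [exact: conn1|exists y, u; split=> //; right; exact: adj_sym].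
- by right.
- by left.
- by apply: connU; [exact: conn1|exact: conn1|exists y', v; split=> //; right;
    exact: adj_sym].
- by right.
- by left.
- move=> x [Rx|/= ->] [/= x_|/= x_].
  + by apply: (PQ y') => //; apply: RP; rewrite -x_.
  + by apply: nNv; rewrite -x_; case: (PNS x (RP x Rx)).
  + by apply: nNu; rewrite x_.
  + by apply: uv.
- move=> x [Rx [|[Qx|Sx]]|/= -> []].
  + exact: uniq_a.
  + by case: (PQ x) => //; apply: RP.
  + by case: (PNS x (RP x Rx)).
  + by move=> /A1sub[/PNS[]|/= us]; [|case: nNu; rewrite us; apply: SN].
  + by move=> [/QNS[]|/SN].
- move=> x [//|/= ->] [/A1sub[/PNS[]//|/= vs]|[/QNS[]//|/SN//]].
  by case: nNv; rewrite vs; apply: SN.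
Qed.

End Separator.
End Plows.

(** * Splits and complete minors *)

Section Splits.
Context {T : Type} (G : sgraph T).
Implicit Types A B D E K P Q S V X W : set T.

(** The vertices [x i] may coincide: in [split_or_complete_minor] they all equal [u]. *)
Record split_config W (u v : T) (U V : set T) (N : nat -> set T)
    (x n : nat -> T) : Prop := SplitConfig {
  sc_sub : U `|` V `<=` W;
  sc_subN : forall i, N i `<=` W;
  sc_connU : conn G U; sc_Uu : U u;
  sc_connV : conn G V; sc_Vv : V v;
  sc_UV : forall z, U z -> V z -> False;
  sc_Ux : forall i, U (x i);
  sc_iec : forall i, iec G (N i `|` [set x i]);
  sc_n : forall i, N i (n i);
  sc_adj : forall i, exists2 r, V r & adj G (n i) r;
  sc_NUV : forall i z, N i z -> (U `|` V) z -> False;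
  sc_N : forall i j z, i < j -> N i z -> N j z -> False }.

Definition splits W u v : Prop := exists U V N x n, split_config W u v U V N x n.

Lemma splitsS W W' u v : W `<=` W' -> splits W u v -> splits W' u v.
Proof.
move=> WW' [U [V [N [x [n []]]]]] *; exists U, V, N, x, n; constructor=> //.
  exact: subset_trans WW'.
by move=> i; apply: subset_trans WW'.
Qed.

Definition touching P Q : Prop := exists x y, [/\ P x, Q y & adj G x y].

Definition apart_touching V V' : Prop :=
  (forall x, V x -> V' x -> False) /\ touching V V'.

(** Branch sets of a countably infinite complete graph, with the pair conditions in the order that
    [greedy_sequence] produces. *)
Definition complete_minor W : Prop := exists V : nat -> set T,
  (forall n, [/\ V n `<=` W, V n !=set0 & conn G (V n)]) /\
  forall m n, m < n -> apart_touching (V n) (V m).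

Lemma complete_minorS W W' : W `<=` W' -> complete_minor W -> complete_minor W'.
Proof.
move=> WW' [V [VW VV]]; exists V; split=> // n.
by have [VnW ? ?] := VW n; split=> //; apply: subset_trans WW'.
Qed.

Definition union_of (l : seq (set T)) : set T :=
  [set x | exists2 V, List.In V l & V x].

Lemma union_of_cons V l : union_of (V :: l) = V `|` union_of l.
Proof.
rewrite predeqE => x; split=> [[V' [->|lV'] V'x]|[Vx|[V' lV' V'x]]].
- by left.
- by right; exists V'.
- by exists V => //; left.
- by exists V' => //; right.
Qed.

Lemma union_of_nil : union_of [::] = set0.
Proof. by rewrite predeqE => x; split=> [[V []]|[]]. Qed.

Lemma union_of_conn (l : seq (set T)) : (forall V, List.In V l -> conn G V) ->
  List.ForallOrdPairs apart_touching l -> conn G (union_of l).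
Proof.
elim: l => [|V [|V' l] IHl] cl pw.
- by rewrite union_of_nil => P [x []].
- by rewrite union_of_cons union_of_nil setU0; apply: cl; left.
rewrite union_of_cons; inversion pw as [|V0 l0 Vl pwl]; subst.
apply: connU; first by apply: cl; left.
  by apply: IHl => // V0 lV0; apply: cl; right.
inversion Vl as [|V0 l0 [_ [x [y [Vx V'y Exy]]]] _]; subst.
exists x, y; split=> //; last by right.
by exists V' => //; left.
Qed.

Lemma conn_finite_links P y (l : seq (set T)) :
  conn G P -> P y ->
  (forall V, List.In V l -> exists x p, [/\ V x, P p & adj G x p]) ->
  exists R, [/\ finite_set R, conn G R, R `<=` P, R y
    & forall V, List.In V l -> touching R V].
Proof.
move=> cP Py; elim: l => [_|V l IHl link].
  exists [set y]; split=> //; [exact: conn1|by move=> z /= ->].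
have [|R [fR cR RP Ry RV]] := IHl; first by move=> V' ?; apply: link; right.
have [|x [p [Vx Pp Exp]]] := link V; first by left.
have [R' [fR' cR' R'P R'y R'p]] := conn_finite_link cP Py Pp.
exists (R `|` R'); split.
- by rewrite finite_setU.
- by apply: connU => //; exists y, y; split=> //; left.
- by move=> z [/RP|/R'P].
- by left.
- move=> V' [<-|/RV[a [b [Ra Vb Eab]]]].
    by exists p, x; split=> //; [right|exact: adj_sym].
  by exists a, b; split=> //; left.
Qed.

(** Without a plow, deleting a finite [S] from [N] leaves the remaining neighbours of [u] finitely
    inseparable. So finite connected sets, each containing a neighbour of [u], can be chosen one
    after another, each touching all earlier ones. *)
Lemma plow_or_complete_minor N W u v :
  iec G N -> N `<=` W -> W u -> W v -> ~ N u -> ~ N v -> u <> v ->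
  infinite_set (neighbours G u `&` N) -> infinite_set (neighbours G v `&` N) ->
  set_plow G W u v \/ complete_minor W.
Proof.
move=> iN NW Wu Wv nNu nNv uv infu infv.
have [|noplow] := pselect (set_plow G W u v); [by left|right].
have sep S y y' P : finite_set S -> S `<=` N -> neighbours G u y -> N y -> ~ S y ->
    neighbours G v y' -> N y' -> ~ S y' -> P y -> ~ P y' ->
    ~ finite_cut G ((N `\` S) `&` P) ((N `\` S) `\` P).
  move=> fS SN Euy Ny nSy Evy' Ny' nSy' Py nPy' fin; apply: noplow.
  apply: (plow_of_separator iN (S0 := S) NW _ _ nNu nNv uv Ny Ny') => //; last
    by exists P.
  by move=> s Ss; split; [exact: SN|move=> [] /= sy; subst].
(* A neighbour of [v] outside [S] lies on one side of the cut, opposite [y1] or [y2], so [sep]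
   applies. *)
have con S y1 y2 P : finite_set S -> S `<=` N -> neighbours G u y1 -> N y1 -> ~ S y1 ->
    neighbours G u y2 -> N y2 -> ~ S y2 -> P y1 -> ~ P y2 ->
    ~ finite_cut G ((N `\` S) `&` P) ((N `\` S) `\` P).
  move=> fS SN Euy1 Ny1 nSy1 Euy2 Ny2 nSy2 Py1 nPy2 fin.
  have [y' [[Evy' Ny'] nSy']] := infinite_meets infv fS.
  have [Py'|nPy'] := pselect (P y'); last by apply: (sep S y1 y' P).
  apply: (sep S y2 y' (~` P)) => //.
  apply: finite_cutS (finite_cutC fin) => a b [NSa nPa] [NSb nnPb] _.
  by split; split=> //; apply: contrapT.
pose good V := [/\ finite_set V, conn G V, V `<=` N & exists2 y, V y & neighbours G u y].
have [l /List.Forall_forall gl _|V [gV VV]] := greedy_sequence (good := good) (R :=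
  apart_touching); last first.
  exists V; split=> // n; have [_ cV VN [y Vy _]] := gV n.
  by split=> //; [exact: subset_trans NW|exists y].
pose S := union_of l.
have fS : finite_set S.
  rewrite /S; elim: l gl {S} => [|V l IHl] gl; first by rewrite union_of_nil.
  rewrite union_of_cons finite_setU; split; first by have [] := gl V (or_introl erefl).
  by apply: IHl => V' lV'; apply: gl; right.
have SN : S `<=` N by move=> z [V /gl[_ _ VN _] /VN].
have [y [[Euy Ny] nSy]] := infinite_meets infu fS.
have [||R [fR cR RP Ry RV]] :=
  @conn_finite_links (component G (N `\` S) y) y l (@component_conn _ _ _ _).
- by apply: component_self.
- move=> V lV; have [_ _ VN [z Vz Euz]] := gl V lV.
  have Sz : S z by exists V.
  (* Only [z] is put back: an edge leaving the component of [y] once [S] loses [z] can end nowhere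
     but in [z]. *)
  have /infinite_cut_ex[a [b [[_ Pa] [[Nb nSb] nPb] Eab]]] :
      ~ finite_cut G ((N `\` (S `\ z)) `&` component G (N `\` S) y)
                     ((N `\` (S `\ z)) `\` component G (N `\` S) y).
    apply: (con _ y z) => //;
      [exact: finite_setD|by move=> w [/SN]|by move=> []|exact: VN|
      by move=> [_ /(_ erefl)]|exact: component_self|by move=> Pz;
        have [_ /(_ Sz)] := component_sub Pz].
  have [bz|nbz] := pselect (b = z); last first.
    case: nPb; apply: component_closed Pa _ Eab; split=> // Sb.
    by apply: nSb.
  by exists z, a; split=> //; rewrite -bz; exact: adj_sym.
exists R; split.
  split=> //; last by exists y.
  by move=> z /RP Pz; have [] := component_sub Pz.
apply/List.Forall_forall => V lV; split; last exact: RV.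
by move=> z /RP Pz Vz; have [_] := component_sub Pz; apply; exists V.
Qed.

End Splits.

(** * Classes of a set and the shedding process *)

Section Classes.
Context {T : Type} (G : sgraph T).
Implicit Types A B D E F K P Q R S V X W : set T.
Variable M : set T.

(* The classes [cl x] partition [M]. *)
Let cl x : set T := iec_hull G M x.

Let cl_sub x z : cl x z -> M z.
Proof. exact: iec_hull_sub. Qed.

Let cl_self x : M x -> cl x x.
Proof. exact: iec_hull_self. Qed.

Let cl_sym x z : cl x z -> cl z x.
Proof. by move=> [A [iA AM Ax] Az]; exists A. Qed.

Let cl_trans x y z : cl x y -> cl y z -> cl x z.
Proof.
move=> [A [iA AM Ax] Ay] [B [iB BM By] Bz]; exists (A `|` B); last by right.
by split; [apply: iecU => //; exists y|move=> w [/AM|/BM]|left].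
Qed.

Definition saturated E : Prop := forall x z, E x -> cl x z -> E z.

Definition span F : set T := \bigcup_(x in F) cl x.

(* Finite unions of classes play the role of finite sets of vertices. *)
Definition finite_span S : Prop := S `<=` M /\ exists2 F, finite_set F & S = span F.

(** Infinitely many edges between two classes would make their union infinitely edge-connected
    inside [M], hence a single class. *)
Lemma finite_cut_classes x y : M x -> M y -> ~ cl x y -> finite_cut G (cl x) (cl y).
Proof.
move=> Mx My nxy; apply: contrapT => inf; apply: nxy.
exists (cl x `|` cl y); last by right; exact: cl_self.
split; last by left; exact: cl_self.
  by apply: iecU_cut => //; exact: iec_hull_iec.
by move=> z [|]; exact: cl_sub.
Qed.

Lemma finite_span0 : finite_span set0.
Proof. by split=> //; exists set0 => //; rewrite /span bigcup_set0. Qed.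

Lemma finite_spanU S S' : finite_span S -> finite_span S' -> finite_span (S `|` S').
Proof.
move=> [SM [F fF SE]] [SM' [F' fF' SE']]; split; first by move=> z [/SM|/SM'].
exists (F `|` F'); first by rewrite finite_setU.
by rewrite /span bigcup_setU -/(span F) -/(span F') SE SE'.
Qed.

Lemma finite_span_of F : finite_set F -> finite_span (span F).
Proof. by move=> fF; split; [move=> z [x _]; exact: cl_sub|exists F]. Qed.

Lemma finite_span_class x : finite_span (cl x).
Proof.
by split; [exact: cl_sub|exists [set x]; rewrite // /span bigcup_set1].
Qed.

Lemma span_self F x : F x -> M x -> span F x.
Proof. by move=> Fx Mx; exists x => //; exact: cl_self. Qed.

Lemma finite_span_saturated S : finite_span S -> saturated S.
Proof.
by move=> [_ [F _ ->]] x z [w Fw wx] xz; exists w => //; exact: cl_trans xz.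
Qed.

Lemma saturatedD E S : saturated E -> saturated S -> E `<=` M -> saturated (E `\` S).
Proof.
move=> sE sS EM x z [Ex nSx] xz; split; first exact: sE xz.
by move=> Sz; apply: nSx; apply: sS Sz _; exact: cl_sym.
Qed.

Lemma finite_cut_span x S : M x -> finite_span S -> finite_cut G (cl x) (S `\` cl x).
Proof.
move=> Mx [SM [F fF SE]].
have : finite_set (\bigcup_(y in F) cut G (cl x) (cl y `\` cl x)).
  apply: bigcup_finite => // y Fy.
  have [xy|nxy] := pselect (cl x y).
    by apply: finite_cut0 => a b _ [yb nxb] _; apply: nxb; exact: cl_trans yb.
  have [My|nMy] := pselect (M y); last first.
    apply: finite_cut0 => a b _ [yb _] _; apply: nMy.
    by apply: cl_sub; exact: cl_sym yb.
  by apply: finite_cutS (finite_cut_classes Mx My nxy) => a b xa [].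
apply: sub_finite_set => -[a b] [/= xa [Sb nxb] Eab].
by move: Sb; rewrite SE => -[y Fy yb]; exists y.
Qed.

Lemma span_conn F : conn G F -> F `<=` M -> conn G (span F).
Proof.
move=> cF FM P [x [z Fz zx] Px] [y [w Fw wy] nPy].
have cC c := iec_conn (@iec_hull_iec _ G M c).
have go c : F c -> (exists2 p, cl c p & P p) -> (exists2 q, cl c q & ~ P q) ->
    exists x y, [/\ span F x, P x, span F y, ~ P y & adj G x y].
  move=> Fc ep eq; have [a [b [ca Pa cb nPb Eab]]] := cC c P ep eq.
  by exists a, b; split=> //; exists c.
have [Pz|nPz] := pselect (P z); last first.
  by apply: (go z) => //; [exists x|exists z => //; apply: cl_self; exact: FM].
have [Pw|nPw] := pselect (P w).
  by apply: (go w) => //; [exists w => //; apply: cl_self; exact: FM|exists y].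
have [||a [b [Fa Pa Fb nPb Eab]]] := cF P; [by exists z|by exists w|].
by exists a, b; split=> //; apply: span_self => //; exact: FM.
Qed.

Lemma component_saturated A x : A `<=` M -> saturated A -> saturated (component G A x).
Proof.
move=> AM sA y z [B [cB BA Bx] By] yz.
have My : M y by apply: AM; exact: BA.
exists (B `|` cl y); last by right.
split; [|move=> w [/BA//|yw]; apply: sA yw; exact: BA|by left].
apply: connU => //; first exact: iec_conn (@iec_hull_iec _ G M y).
by exists y, y; split=> //; [exact: cl_self|left].
Qed.

Variables (u v : T).
Hypothesis nMu : ~ M u.

Definition good E : Prop :=
  [/\ E `<=` M, saturated E, iec G (E `|` [set u])
    & infinite_set (neighbours G v `&` E)].

(* [X] is cut off from [E] and hangs on [R + v]; the process goes on in [E']. *)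
Definition sheds E X R x E' : Prop :=
  [/\ X `<=` E, R `<=` E, (forall z, X z -> R z -> False), conn G (R `|` [set v])
    & iec G (X `|` [set u])] /\
  [/\ X x, (exists2 r, (R `|` [set v]) r & adj G x r), E' `<=` E,
      (forall z, E' z -> X z \/ R z -> False) & good E'].

Definition shedding E : Prop := exists X R x E', sheds E X R x E'.

Lemma sheddingS E E' : E `<=` E' -> shedding E -> shedding E'.
Proof.
move=> EE' [X [R [x [E1 [[XE RE XR cR iX] [Xx adjx E1E E1XR gE1]]]]]].
exists X, R, x, E1; split; split=> //; exact: subset_trans EE'.
Qed.

Lemma iec_closed_part E P : iec G (E `|` [set u]) -> ~ E u -> P `<=` E ->
  (forall a b, P a -> E b -> adj G a b -> P b) -> iec G (P `|` [set u]).
Proof.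
move=> iE nEu PE clP; apply: (@linked_iec _ _ _ u); first by right.
move=> X [x [Px|/= xu] Xx] Xu fin; last by apply: (Xu x) => //; right.
apply: (iE (P `&` X)).
- by exists x => //; left; exact: PE.
- by exists u; [right|move=> [/PE]].
apply: finite_cutS fin => a b [_ [Pa Xa]] [Eb nb] Eab.
split; first by split=> //; left.
case: Eb => [Eb|/= bu].
  by have Pb := clP a b Pa Eb Eab; split; [left|move=> Xb; apply: nb].
by split; [right|move=> Xb; apply: (Xu b) => //; right].
Qed.

(** Classes are removed one at a time. Each is maximal among the infinitely edge-connected sets
    avoiding [u], so [linkedD] keeps the rest linked to [u]. *)
Lemma iecD_span E S : E `<=` M -> saturated E -> iec G (E `|` [set u]) ->
  finite_span S -> iec G ((E `\` S) `|` [set u]).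
Proof.
move=> EM sE iE [_ [F fF ->]]; elim/finite_set_ind: F / fF => [|x F fF _ IH].
  by rewrite /span bigcup_set0 setD0.
have sD : saturated (E `\` span F).
  by apply: saturatedD => //; apply: finite_span_saturated; exact: finite_span_of.
have DE : E `\` span (x |` F) = (E `\` span F) `\` cl x.
  rewrite /span bigcup_setU bigcup_set1 predeqE => z; split.
    by move=> [Ez nz]; split; [split=> // ?; apply: nz; right|move=> ?; apply: nz; left].
  by move=> [[Ez nz] nxz]; split=> // -[].
have [Dx|nDx] := pselect ((E `\` span F) x); last first.
  have -> // : E `\` span (x |` F) = E `\` span F.
  rewrite DE predeqE => z; split=> [[]//|Dz]; split=> // xz.
  by apply: nDx; apply: sD Dz _; exact: cl_sym.
have Mx : M x by apply: EM; case: Dx.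
have nxu : ~ cl x u by move=> /cl_sub.
have <- : ((E `\` span F) `|` [set u]) `\` cl x = (E `\` span (x |` F)) `|` [set u].
  rewrite DE predeqE => z; split=> [[[Dz|/= ->] nxz]|[[Dz nxz]|/= ->]].
  - by left.
  - by right.
  - by split=> //; left.
  - by split=> //; right.
apply: (@linked_iec _ _ _ u); first by split=> //; right.
apply: linkedD.
- by exists x; exact: cl_self.
- exact: iec_hull_iec.
- move=> z xz; split; first by left; apply: sD xz.
  by move=> /= zu; apply: nxu; rewrite -zu.
- move=> K iK xK Ksub z Kz; apply: (iec_hull_max iK) (Kz); last by apply: xK;
    exact: cl_self.
  by move=> w /Ksub[[[/EM//]|//]].
- by apply: (@iec_linked _ _ _ _ u) => //; [right|left].
Qed.

Hypothesis finite_neighbours : forall D, iec G D -> D `<=` M ->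
  finite_set (neighbours G v `&` D).

Lemma finite_neighbours_span S : finite_span S -> finite_set (neighbours G v `&` S).
Proof.
move=> [SM [F fF ->]]; rewrite /span setI_bigcupr; apply: bigcup_finite => // x _.
by apply: finite_neighbours; [exact: iec_hull_iec|exact: cl_sub].
Qed.

Lemma goodD_span E S : good E -> finite_span S -> good (E `\` S).
Proof.
move=> [EM sE iE infE] fS; split.
- by move=> z [/EM].
- by apply: saturatedD => //; exact: finite_span_saturated.
- exact: iecD_span.
- move=> fin; apply: infE.
  apply: sub_finite_set (finite_setU2 fin (finite_neighbours_span fS)) => z [Evz Ez].
  by have [Sz|nSz] := pselect (S z); [right|left].
Qed.

(** [v] has infinitely many neighbours in [P] or in the rest of [E] outside [S]. That part continues
    as the new good set; the other, which touches [S] plus [v], is shed. *)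
Lemma shedding_disconnected E S P : good E -> finite_span S -> S `<=` E ->
  conn G (S `|` [set v]) -> P `<=` E `\` S -> saturated P ->
  (forall a b, P a -> (E `\` S) b -> adj G a b -> P b) ->
  touching G P (S `|` [set v]) ->
  touching G ((E `\` S) `\` P) (S `|` [set v]) -> shedding E.
Proof.
move=> gE fS SE cS PES sP clP tP tP'.
have [DM sD iD infD] := goodD_span gE fS.
have nDu : ~ (E `\` S) u by move=> /DM.
have iP := iec_closed_part iD nDu PES clP.
have iP' : iec G (((E `\` S) `\` P) `|` [set u]).
  apply: (iec_closed_part iD nDu) => [z []//|a b [Da nPa] Db Eab]; split=> // Pb.
  by apply: nPa; apply: clP Pb Da _; exact: adj_sym.
have sP' : saturated ((E `\` S) `\` P) by exact: saturatedD.
have [fin|inf] := pselect (finite_set (neighbours G v `&` P)).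
  have [x [r [Px Sr Exr]]] := tP.
  exists P, S, x, ((E `\` S) `\` P); split; split=> //.
  - by move=> z /PES[].
  - by move=> z /PES[].
  - by exists r.
  - by move=> z [[]].
  - by move=> z [[_ nSz] nPz] [].
  - split=> //; first by move=> z [/DM].
    move=> fin'; apply: infD; apply: sub_finite_set (finite_setU2 fin fin') => z [Evz Dz].
    by have [Pz|nPz] := pselect (P z); [left|right].
have [x [r [Px Sr Exr]]] := tP'.
exists ((E `\` S) `\` P), S, x, P; split; split=> //.
- by move=> z [[]].
- by move=> z [[]].
- by exists r.
- by move=> z /PES[].
- by move=> z Pz [[_ /(_ Pz)]|Sz] //; have [] := PES z Pz.
- by split=> // z /PES/DM.
Qed.


(** If nothing can be shed, removing a connected finite span with a neighbour of [v] keeps [E]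
    connected, and every removed class still has an edge to what remains. Finite spans can then be
    chosen greedily as branch sets of a complete minor. *)
Lemma good_conn_shedding E : good E -> conn G E -> shedding E \/ complete_minor G M.
Proof.
move=> gE cE; have [|nsh] := pselect (shedding E); [by left|right].
have [EM sE iE infE] := gE.
have [y0 [Evy0 Ey0]] := infinite_setN0 infE.
(* A class with infinitely many edges to [u] could itself be cut off. *)
have thin x : E x -> finite_cut G (cl x) [set u].
  move=> Ex; have Mx := EM _ Ex; apply: contrapT => fat; apply: nsh.
  have iX : iec G (cl x `|` [set u]).
    by apply: iecU_cut fat; [exact: iec_hull_iec|exact: iec1].
  (* A class containing the neighbour [y0] of [v] is attached to [v] directly, with [R] empty; any
     other is attached through the span of a link from [y0]. *)
  have [xy0|nxy0] := pselect (cl x y0).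
    exists (cl x), set0, y0, (E `\` cl x); split; split=> //.
    - by move=> z; exact: sE.
    - by rewrite set0U; exact: conn1.
    - by exists v; [right|exact: adj_sym].
    - by move=> z [_ nxz] [].
    - by apply: goodD_span => //; exact: finite_span_class.
  have [|R0 [fR0 cR0 R0E R0y0 [r [y [R0r Ey xy Ery]]]]] := conn_exit cE Ey0 nxy0.
    by exists x => //; exact: cl_self.
  have R0M : R0 `<=` M by move=> z /R0E[/EM].
  have fR : finite_span (span R0) by exact: finite_span_of.
  exists (cl x), (span R0), y, (E `\` (span R0 `|` cl x)); split; split=> //.
  - by move=> z; exact: sE.
  - by move=> z [w /R0E[Ew _]]; exact: sE.
  - move=> z xz [w /R0E[_ nxw] wz]; apply: nxw; apply: cl_trans xz _.
    exact: cl_sym.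
  - apply: connU; [exact: span_conn|exact: conn1|exists y0, v; split=> //].
      by apply: span_self => //; exact: R0M.
    by right; exact: adj_sym.
  - by exists r; [left; apply: span_self => //; exact: R0M|exact: adj_sym].
  - by move=> z [_ nz] [?|?]; apply: nz; [right|left].
  - by apply: goodD_span => //; apply: finite_spanU => //; exact: finite_span_class.
(* If [E] minus [S] fell apart, the component [C] and its complement would both touch [S], as [E] is
   connected, and one of them could be shed. *)
have connD S : finite_span S -> S `<=` E -> conn G S ->
    (exists2 y, S y & neighbours G v y) -> conn G (E `\` S).
  move=> fS SE cS [s Ss Evs] P [x DSx Px] [y DSy nPy]; apply: contrapT => no.
  pose C := component G (E `\` S) x.
  have Cx : C x by exact: component_self.
  have CD z : C z -> (E `\` S) z by exact: component_sub.
  have nCy : ~ C y.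
    move=> Cy; have [||a [b [Ca Pa Cb nPb Eab]]] := @component_conn _ G (E `\` S) x P.
    - by exists x.
    - by exists y.
    by apply: no; exists a, b; split=> //; exact: CD.
  have clC a b : C a -> (E `\` S) b -> adj G a b -> C b by exact: component_closed.
  have nCs : ~ C s by move=> /CD[].
  apply: nsh; apply: (shedding_disconnected gE fS SE (P := C)) => //.
  - by apply: connU => //; [exact: conn1|exists s, v; split=> //; right; exact: adj_sym].
  - apply: component_saturated; first by move=> z [/EM].
    by apply: saturatedD => //; exact: finite_span_saturated.
  - have [||a [b [Ea Ca Eb nCb Eab]]] := cE C.
    + by exists x => //; case: DSx.
    + by exists s => //; exact: SE.
    exists a, b; split=> //; left; apply: contrapT => nSb.
    by apply: nCb; apply: clC Eab.
  - have [||a [b [Ea C'a Eb nC'b Eab]]] := cE ((E `\` S) `\` C).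
    + by exists y; [case: DSy|].
    + by exists x; [case: DSx|move=> []].
    exists a, b; split=> //; left; apply: contrapT => nSb.
    apply: nC'b; split=> // Cb; case: C'a => Da; apply.
    by apply: clC Cb _ _ => //; exact: adj_sym.
pose ok V := [/\ finite_span V, conn G V, V `<=` E & exists2 y, V y & neighbours G v y].
have [l /List.Forall_forall okl pw|V [okV VV]] :=
    greedy_sequence (good := ok) (R := apart_touching G); last first.
  exists V; split=> // n; have [_ cV VE [y Vy _]] := okV n.
  by split=> //; [exact: subset_trans EM|exists y].
pose S := union_of l.
have SE : S `<=` E by move=> z [V /okl[_ _ VE _] /VE].
have fS : finite_span S.
  rewrite /S; elim: l okl {S pw SE} => [|V l IHl] okl; first by rewrite union_of_nil;
    exact: finite_span0.
  rewrite union_of_cons; apply: finite_spanU; first by have [] := okl V (or_introl erefl).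
  by apply: IHl => V' lV'; apply: okl; right.
have cD : conn G (E `\` S).
  case El : l => [|V l'].
    by rewrite /S El union_of_nil setD0.
  have lV : List.In V l by rewrite El; left.
  apply: connD => //.
    by apply: union_of_conn => // V' /okl[].
  by have [_ _ _ [y Vy Evy]] := okl V lV; exists y => //; exists V.
have [y [[Evy Ey] nSy]] := infinite_meets infE (finite_neighbours_span fS).
have Dy : (E `\` S) y by split=> // Sy; apply: nSy.
have [|R [fR cR RD Ry RV]] := @conn_finite_links _ G (E `\` S) y l cD Dy.
  move=> V lV; have [fV _ VE [x Vx _]] := okl V lV.
  have Ex := VE _ Vx; have Mx := EM _ Ex.
  have xV z : cl x z -> V z by exact: finite_span_saturated.
  have nxu : ~ cl x u by move=> /cl_sub.
  (* Otherwise all edges leaving the class of [x] in [E] plus [u] end in [u] or in [S], and these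
     are finitely many by [thin] and [finite_cut_span]. *)
  apply: contrapT => no; apply: (iE (cl x)).
  - by exists x; [left|exact: cl_self].
  - by exists u; [right|].
  apply: finite_cutU (thin x Ex) (finite_cut_span Mx fS) => a b [_ xa] [Eb nxb] Eab.
  case: Eb => [Eb|]; [right|by left]; split=> //; split=> //.
  apply: contrapT => nSb; apply: no; exists a, b; split=> //; exact: xV.
have RM : R `<=` M by move=> z /RD[/EM].
have sD : saturated (E `\` S) by apply: saturatedD => //; exact: finite_span_saturated.
have spanD : span R `<=` E `\` S by move=> z [w /RD Dw wz]; exact: sD wz.
have Rspan z : R z -> span R z by move=> Rz; apply: span_self => //; exact: RM.
exists (span R); split.
  split; [exact: finite_span_of|exact: span_conn|by move=> z /spanD[]|].
  by exists y => //; exact: Rspan.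
apply/List.Forall_forall => V lV; split.
  by move=> z /spanD[_ nSz] Vz; apply: nSz; exists V.
have [a [b [Ra Vb Eab]]] := RV V lV.
by exists a, b; split=> //; exact: Rspan.
Qed.

(** Reduction to connected [E]. If neighbours of [v] lay in different components, [E] could be
    divided with [S] empty; otherwise a single component contains them all and is good. *)
Lemma good_shedding E : good E -> shedding E \/ complete_minor G M.
Proof.
move=> gE; have [|nsh] := pselect (shedding E); [by left|right].
have [EM sE iE infE] := gE.
have nEu : ~ E u by move=> /EM.
have [y0 [Evy0 Ey0]] := infinite_setN0 infE.
pose E1 := component G E y0.
have E1y0 : E1 y0 by exact: component_self.
have E1E z : E1 z -> E z by exact: component_sub.
have sE1 : saturated E1 by exact: component_saturated.
have clE1 a b : E1 a -> E b -> adj G a b -> E1 b by exact: component_closed.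
have nbE1 z : neighbours G v z -> E z -> E1 z.
  move=> Evz Ez; apply: contrapT => nE1z; apply: nsh.
  apply: (shedding_disconnected gE finite_span0 (P := E1)) => //.
  - by rewrite set0U; exact: conn1.
  - by rewrite setD0.
  - by rewrite setD0.
  - by exists y0, v; split=> //; [right|exact: adj_sym].
  - by exists z, v; split; [rewrite setD0|right|exact: adj_sym].
have gE1 : good E1.
  split=> //; first by move=> z /E1E/EM.
    exact: iec_closed_part clE1.
  by apply: sub_infinite_set infE => z [Evz Ez]; split=> //; exact: nbE1.
have [shE1|//] := good_conn_shedding gE1 (@component_conn _ _ _ _).
by case: nsh; exact: sheddingS shE1.
Qed.

(** Shedding is iterated: the shed sets [X n], all attached to [u], become the sets [N i] of the
    split, and the sets [R n] together with [v] form its side [V]. *)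
Lemma split_or_complete_minor W :
  M `<=` W -> W u -> W v -> ~ M v -> u <> v -> iec G (M `|` [set u]) ->
  infinite_set (neighbours G v `&` M) -> splits G W u v \/ complete_minor G W.
Proof.
move=> MW Wu Wv nMv uv iM infM.
have [|ncm] := pselect (complete_minor G W); [by right|left].
have gM : good M by split=> // x z _; exact: cl_sub.
pose next (E E' : {E | good E}) := exists X R x, sheds (sval E) X R x (sval E').
have step (E : {E | good E}) : exists E' : {E | good E}, next E E'.
  case: E => E gE; have [[X [R [x [E' shE]]]]|cm] := good_shedding gE; last first.
    by case: ncm; exact: complete_minorS cm.
  have gE' : good E' by case: shE => _ [].
  by exists (exist _ E' gE'), X, R, x.
have [f [_ fS]] := dependent_chain (exist _ M gM) step.
have /choice[g gP] : forall n, exists t : set T * set T * T,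
    sheds (sval (f n)) t.1.1 t.1.2 t.2 (sval (f n.+1)).
  by move=> n; have [X [R [x sh]]] := fS n; exists (X, R, x).
pose E n := sval (f n); pose X n := (g n).1.1; pose R n := (g n).1.2; pose x n := (g n).2.
have EM n : E n `<=` M by rewrite /E; case: (f n) => /= ? [].
have XE n : X n `<=` E n by have [[]] := gP n.
have RE n : R n `<=` E n by have [[]] := gP n.
have XR n z : X n z -> R n z -> False by have [[_ _ h _ _] _] := gP n; exact: h.
have EE n : E n.+1 `<=` E n by have [_ []] := gP n.
have EXR n z : E n.+1 z -> X n z \/ R n z -> False.
  by have [_ [_ _ _ h _]] := gP n; exact: h.
have Ele m n : m <= n -> E n `<=` E m.
  move=> /subnKC <-; elim: (n - m) => [|k IHk]; first by rewrite addn0.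
  by rewrite addnS; apply: subset_trans IHk.
have VE : [set v] `|` \bigcup_n R n `<=` M `|` [set v].
  by move=> z [/= ->|[n _ /RE/EM]]; [right|left].
have nXv n : ~ X n v by move=> /XE/EM.
exists [set u], ([set v] `|` \bigcup_n R n), X, (fun=> u), x; constructor=> //.
- by move=> z [/= ->//|/VE[/MW|/= ->]].
- by move=> i z /XE/EM/MW.
- exact: conn1.
- have -> : [set v] `|` \bigcup_n R n = \bigcup_n (R n `|` [set v]).
    rewrite predeqE => z; split=> [[/= ->|[n _ Rz]]|[n _ [Rz|/= ->]]].
    + by exists 0 => //; right.
    + by exists n => //; left.
    + by right; exists n.
    + by left.
  apply: (@conn_bigU _ _ _ _ _ v) => n _; split; last by right.
  by have [[]] := gP n.
- by left.
- by move=> z /= -> /VE[].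
- by move=> i; have [[]] := gP i.
- by move=> i; have [_ []] := gP i.
- move=> i; have [_ [_ [r Rr Exr] _ _ _]] := gP i; exists r => //.
  by case: Rr => [Rr|/= ->]; [right; exists i|left].
- move=> i z Xz [/= zu|[/= zv|[j _ Rz]]].
  + by apply: nMu; rewrite -zu; exact: (EM i _ (XE i _ Xz)).
  + by apply: nMv; rewrite -zv; exact: (EM i _ (XE i _ Xz)).
  + case: (ltngtP i j) => [ij|ji|ij]; last by move: Rz; rewrite -ij; exact: XR Xz.
      by apply: (EXR i z); [apply: (Ele i.+1 j ij); exact: RE|left].
    by apply: (EXR j z); [apply: (Ele j.+1 i ji); exact: XE|right].
- move=> i j z ij Xi Xj.
  by apply: (EXR i z); [apply: (Ele i.+1 j ij); exact: XE|left].
Qed.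

End Classes.

(** * The alternative between a plow, a split and a complete minor *)

Section Alternative.
Context {T : Type} (G : sgraph T).
Implicit Types A B D E K N P Q S V X W : set T.

(** By maximality of the hull, [linkedD] with [S] equal to [[set u]] leaves the complement linked to
    [u]. *)
Lemma iecD_hull W u v : iec G W -> W u -> W v -> u <> v ->
  iec G (W `\` iec_hull G (W `\ u) v).
Proof.
move=> iW Wu Wv uv; have nKu : ~ iec_hull G (W `\ u) v u by move=> Ku; have [_] :=
  iec_hull_sub Ku; apply.
apply: (@linked_iec _ _ _ u) => //; apply: linkedD.
- by exists v; apply: iec_hull_self; split=> // /esym.
- exact: iec_hull_iec.
- exact: iec_hull_sub.
- move=> K iK hK KW; apply: iec_hull_max => //; apply: hK.
  by apply: iec_hull_self; split=> // /esym.
- by apply: (iec_linked iW Wu); left.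
Qed.

Lemma iec_finite_cut_part N Q u : iec G (N `|` [set u]) -> ~ N u -> Q `<=` N ->
  finite_cut G Q (N `\` Q) -> iec G (Q `|` [set u]).
Proof.
move=> iN nNu QN fQ; apply: (@linked_iec _ _ _ u); first by right.
move=> X [x Qux Xx] Xu fin.
have Qx : Q x by case: Qux => // xu; case: (Xu x) => //; right.
apply: (iN (Q `&` X)).
- by exists x => //; left; exact: QN.
- by exists u; [right|move=> [/QN]].
apply: finite_cutU fin fQ => a b [_ [Qa Xa]] [Nb nb] _.
have [Qb|nQb] := pselect (Q b).
  by left; split; split; [left| |left|move=> Xb; apply: nb].
case: Nb => [Nb|/= ->]; first by right.
by left; split; split; [left| |right|move=> Xw; apply: (Xu u) => //; right].
Qed.

Lemma neighboursU1 N u : iec G (N `|` [set u]) -> N !=set0 -> ~ N u ->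
  infinite_set (neighbours G u `&` N).
Proof.
move=> iN [x Nx] nNu; have := iec_infinite_neighbours iN (or_intror erefl).
move=> /(_ (ex_intro2 _ _ x (or_introl Nx) (fun xu => nNu (eq_ind x N Nx u xu)))).
apply: sub_infinite_set => z [Euz [Nz|/= zu]] //.
by case: (adj_irrefl (s := G) (x := u)); move: Euz; rewrite zu.
Qed.

Lemma alternative_deleted W u v :
  iec G W -> iec G (W `\ v) -> W u -> W v -> u <> v ->
  [\/ set_plow G W u v, splits G W u v | complete_minor G W].
Proof.
move=> iW iWv Wu Wv uv; pose M := (W `\ v) `\ u.
have MW : M `<=` W by move=> z [[]].
have nMu : ~ M u by move=> [_]; apply.
have nMv : ~ M v by move=> [[_ +] _]; apply.
have Mu : M `|` [set u] = W `\ v.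
  rewrite predeqE => z; split=> [[[]|/= ->]|Wz] //.
  by have [->|zu] := pselect (z = u); [right|left].
have infM : infinite_set (neighbours G v `&` M).
  move=> fin; apply: (iec_infinite_neighbours iW Wv); first by exists u.
  apply: sub_finite_set (finite_setU2 fin (finite_set1 u)) => z [Evz Wz].
  have [->|zu] := pselect (z = u); [by right|left; split=> //; split=> //; split=> //].
  by move=> /= zv; apply: (adj_irrefl (s := G) (x := v)); move: Evz; rewrite zv.
have [hD|/existsNP[D /not_implyP[iD /not_implyP[DM infD]]]] :=
    pselect (forall D, iec G D -> D `<=` M -> finite_set (neighbours G v `&` D)).
  have [|s|c] := split_or_complete_minor nMu hD MW Wu Wv nMv uv _ infM.
  - by rewrite Mu.
  - by constructor 2.
  - by constructor 3.
(* From here on [D] contains infinitely many neighbours of [v], so [D] plus [v] lies in the hull [K]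
   of [v]. *)
have iDv : iec G (D `|` [set v]).
  apply: iecU_cut iD (@iec1 _ G v) _ => /finite_cutC/finite_cut_point; exact: infD.
pose K := iec_hull G (W `\ u) v.
have KWu : K `<=` W `\ u by exact: iec_hull_sub.
have KW : K `<=` W by move=> z /KWu[].
have nKu : ~ K u by move=> /KWu[_]; apply.
have iK : iec G K by exact: iec_hull_iec.
have Kv : K v by apply: iec_hull_self; split=> // /esym.
have iL : iec G (W `\` K) by exact: iecD_hull.
have DK : D `<=` K.
  suff : D `|` [set v] `<=` K by move=> DvK z Dz; apply: DvK; left.
  apply: (iec_hull_max iDv); last by right.
  by move=> z [/DM[[Wz _] zu]|/= ->] //; split=> // /esym.
have [[k [l [Lk ku Kl lv Ekl]]]|noKL] := pselect (exists k l,
    [/\ (W `\` K) k, k <> u, K l, l <> v & adj G k l]).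
  constructor 1; apply: (plow_of_disjoint iL iK _ KW _ _ Lk ku Kv Kl lv Ekl) => //.
  by move=> z [].
have [d [_ Dd]] := infinite_setN0 infD.
have dv : d <> v by move=> dv; apply: nMv; apply: DM; rewrite -dv.
(* A component of [K] without [v] is joined to the rest of [K] only through [v], so [N] plus [v]
   inherits infinite edge-connectivity. *)
pose N := component G (K `\ v) d.
have Nd : N d by apply: component_self; split=> //; exact: DK.
have NK z : N z -> (K `\ v) z by exact: component_sub.
have clN a b : N a -> (K `\ v) b -> adj G a b -> N b by exact: component_closed.
have NW : N `<=` W by move=> z /NK[/KW].
have nNu : ~ N u by move=> /NK[/nKu].
have nNv : ~ N v by move=> /NK[_]; apply.
have iNv : iec G (N `|` [set v]).
  apply: iec_closed_part clN.
  - have -> // : (K `\ v) `|` [set v] = K.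
    rewrite predeqE => z; split=> [[[]|/= ->]|Kz] //.
    by have [->|zv] := pselect (z = v); [right|left].
  - by move=> [_]; apply.
  - by move=> z /NK.
(* By [noKL], edges leaving [N] inside [W] minus [v] end in [u], and [W] minus [v] is infinitely
   edge-connected. *)
have iNu : iec G (N `|` [set u]).
  apply: (@linked_iec _ _ _ u); first by right.
  move=> X [x Nux Xx] Xu fin.
  have Nx : N x by case: Nux => // xu; case: (Xu x) => //; right.
  apply: (iWv (N `&` X)).
  - by exists x => //; case: (NK _ Nx) => /KW.
  - by exists u => // -[].
  apply: finite_cutS fin => a b [_ [Na Xa]] [[Wb bv] nb] Eab.
  split; first by split=> //; left.
  have [->|bu] := pselect (b = u).
    by split; [right|move=> Xu'; apply: (Xu u) => //; right].
  have [Kb|nKb] := pselect (K b).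
    have Nb : N b by apply: clN Eab.
    by split; [left|move=> Xb; apply: nb].
  case: noKL; exists b, a; have [Ka av] := NK _ Na.
  by split=> //; exact: adj_sym.
have [iN|/existsNP[P /not_implyP[[x Nx Px] /not_implyP[[y Ny nPy] /contrapT fin]]]] :=
    pselect (iec G N).
  have [p|c] := plow_or_complete_minor iN NW Wu Wv nNu nNv uv
    (neighboursU1 iNu (ex_intro _ d Nd) nNu) (neighboursU1 iNv (ex_intro _ d Nd) nNv).
    by constructor 1.
  by constructor 3.
(* The sides of a finite cut of [N] become infinitely edge-connected once [u] is added to one and
   [v] to the other; connectedness of [N] supplies the edge contracted to the head. *)
have [||a [b [Na Pa Nb nPb Eab]]] := @component_conn _ G (K `\ v) d P.
- by exists x.
- by exists y.
have i1 : iec G ((N `&` P) `|` [set u]).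
  apply: (iec_finite_cut_part iNu nNu) => [z []//|].
  apply: finite_cutS fin => z w NPz [Nw nNPw] _; split=> //.
  by split=> // Pw; apply: nNPw.
have i2 : iec G ((N `\` P) `|` [set v]).
  apply: (iec_finite_cut_part iNv nNv) => [z []//|].
  apply: finite_cutS (finite_cutC fin) => z w NPz [Nw nNPw] _; split=> //.
  by split=> //; apply: contrapT => nPw; apply: nNPw.
constructor 1; apply: (plow_of_disjoint (k := a) (l := b) i1 i2) => //.
- by move=> z [[/NW]|/= ->].
- by move=> z [[/NW]|/= ->].
- by move=> z [[Nz Pz]|/= ->] [[Nz' nPz]|/= zv] //; apply: nNv; rewrite -zv.
- by right.
- by left.
- by move=> au; apply: nNu; rewrite -au.
- by right.
- by left.
- by move=> bv; apply: nNv; rewrite -bv.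
Qed.

(** Unless an edge between [K] and [L] avoiding [u] and [v] gives a plow, infinitely many edges run
    from [K] to [v] or from [L] to [u]. Adding that vertex reduces to [alternative_deleted], in the
    second case with [u] and [v] exchanged. *)
Lemma plow_split_or_complete_minor W u v :
  iec G W -> W u -> W v -> u <> v ->
  [\/ set_plow G W u v, splits G W u v, splits G W v u | complete_minor G W].
Proof.
move=> iW Wu Wv uv; pose K := iec_hull G (W `\ v) u; pose L := W `\` K.
have KWv : K `<=` W `\ v by exact: iec_hull_sub.
have KW : K `<=` W by move=> z /KWv[].
have LW : L `<=` W by move=> z [].
have nKv : ~ K v by move=> /KWv[_]; apply.
have iK : iec G K by exact: iec_hull_iec.
have Ku : K u by exact: iec_hull_self.
have iL : iec G L by apply: iecD_hull => // /esym.
have Lv : L v by [].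
have nLu : ~ L u by move=> [].
have [[k [l [Kk ku Ll lv Ekl]]]|noKL] := pselect (exists k l,
    [/\ K k, k <> u, L l, l <> v & adj G k l]).
  constructor 1; apply: (plow_of_disjoint iK iL KW LW _ Ku Kk ku Lv Ll lv Ekl).
  by move=> z Kz [].
have [fK|infK] := pselect (finite_cut G K [set v]); last first.
  have E : (K `|` [set v]) `\ v = K.
    rewrite predeqE => z; split=> [[[]//]|Kz]; split; first by left.
    by move=> /= zv; apply: nKv; rewrite -zv.
  have KvW : K `|` [set v] `<=` W by move=> z [/KW|/= ->].
  have [|||||p|s|c] := @alternative_deleted (K `|` [set v]) u v.
  - by apply: iecU_cut => //; exact: iec1.
  - by rewrite E.
  - by left.
  - by right.
  - by [].
  - by constructor 1; exact: set_plowS p.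
  - by constructor 2; exact: splitsS s.
  - by constructor 4; exact: complete_minorS c.
have infL : ~ finite_cut G L [set u].
  move=> fL; apply: (iW K); [by exists u|by exists v|].
  apply: finite_cutU fK (finite_cutC fL) => a b [_ Ka] Lb Eab.
  have [->|au] := pselect (a = u); first by right.
  have [->|bv] := pselect (b = v); first by left.
  by case: noKL; exists a, b.
have E : (L `|` [set u]) `\ u = L.
  rewrite predeqE => z; split=> [[[]//]|Lz]; split; first by left.
  by move=> /= zu; apply: nLu; rewrite -zu.
have LuW : L `|` [set u] `<=` W by move=> z [/LW|/= ->].
have [|||||p|s|c] := @alternative_deleted (L `|` [set u]) v u.
- by apply: iecU_cut => //; exact: iec1.
- by rewrite E.
- by left.
- by right.
- by move=> /esym.
- by constructor 1; apply: set_plowS (set_plowC p).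
- by constructor 3; exact: splitsS s.
- by constructor 4; exact: complete_minorS c.
Qed.

End Alternative.

(** * Minors of the form T * t *)

Section SeqTree.

(** The tail of a sequence is its parent, so the latest branching choice stands at the front. *)
Definition seq_tree_adj (l m : seq nat) : Prop :=
  (exists i, m = i :: l) \/ (exists i, l = i :: m).

Let seq_tree_sym l m : seq_tree_adj l m -> seq_tree_adj m l.
Proof. by case; [right|left]. Qed.

Let seq_tree_irrefl l : ~ seq_tree_adj l l.
Proof. by case=> -[i /(congr1 size)] /= /n_Sn. Qed.

Let seq_tree_vset l m : seq_tree_adj l m -> [set: seq nat] l.
Proof. by []. Qed.

Definition seq_tree : sgraph (seq nat) :=
  SGraph seq_tree_sym seq_tree_irrefl seq_tree_vset.

Lemma succ_succ_modn n i : 2 < n -> i < n -> (i.+1 %% n).+1 %% n <> i.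
Proof.
move=> n2; rewrite leq_eqVlt => /orP[/eqP ni|lt].
  rewrite ni modnn modn_small ?(ltnW n2) // => i1.
  by rewrite -ni -i1 in n2.
rewrite (modn_small lt); move: lt; rewrite leq_eqVlt => /orP[/eqP ni|lt].
  by rewrite ni modnn => i0; rewrite -ni -i0 in n2.
by rewrite modn_small // => /eqP; rewrite -addn2 -{2}[i]addn0 eqn_add2l.
Qed.

(** Both neighbours of a longest sequence on a cycle must be its tail, whereas a cycle of length
    above 2 has distinct ones. *)
Lemma seq_tree_acyclic : acyclic seq_tree.
Proof.
move=> [n [c [n2 cI cE]]].
have i0 : 'I_n by exact: Ordinal (ltnW (ltnW n2)).
have [i _ imax] := arg_maxnP (fun i : 'I_n => size (c i)) (erefl : xpredT i0).
have parent j : seq_tree_adj (c i) (c j) -> exists a, c i = a :: c j.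
  by case=> [[a cj]|//]; have := imax j isT; rewrite cj /= ltnn.
have [a ca] := parent _ (cE i).
have [b cb] : exists b, c i = b :: c (ord_pred i).
  by apply: parent; apply: seq_tree_sym; have := cE (ord_pred i); rewrite ord_predK.
have /cI /(congr1 (@ordS n)) : c (ordS i) = c (ord_pred i) by move: ca; rewrite cb => -[].
rewrite ord_predK => /(congr1 val) /=.
exact: succ_succ_modn.
Qed.

Lemma seq_tree_T_aleph0 : T_aleph0 seq_tree.
Proof.
split=> [|l _].
  split; [by exists [::]| |exact: seq_tree_acyclic].
  have root l : joined seq_tree l [::].
    elim: l => [|i l IHl]; first exact: rt_refl.
    by apply: rt_trans IHl; apply: rt_step; right; exists i.
  have toor l : joined seq_tree [::] l.
    elim: l => [|i l IHl]; first exact: rt_refl.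
    by apply: rt_trans IHl _; apply: rt_step; left; exists i.
  by move=> l m _ _; apply: rt_trans (root l) (toor m).
apply/card_eqP/card_eqP; rewrite card_eq_le; apply/andP; split.
  by have := countableP (neighbours seq_tree l).
apply/infiniteP => fin; apply: infinite_nat.
have : finite_set ((fun m : seq nat => head 0 m) @` (neighbours seq_tree l))
  by exact: finite_image.
by apply: sub_finite_set => i _; exists (i :: l) => //; left; exists i.
Qed.

End SeqTree.

Section Minors.
Context {T : Type} (G : sgraph T).
Implicit Types A B P Q R X : set T.

Lemma conn_connected A : conn G A -> connected (induced G A).
Proof.
move=> cA x y [_ Ax] [_ Ay]; apply: contrapT => nxy.
have [||a [b [Aa xa Ab nxb Eab]]] := cA (joined (induced G A) x).
- by exists x => //; exact: rt_refl.
- by exists y.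
by apply: nxb; apply: rt_trans xa _; apply: rt_step.
Qed.

(** The cone has countably many vertices, so an injective numbering assigns them branch sets, with 0
    kept for [t]. *)
Lemma star_minor_of_complete_minor :
  complete_minor G (vset G) -> has_T_aleph0_star_t_minor G.
Proof.
move=> [V [VW VV]]; exists (seq nat), seq_tree; split; first exact: seq_tree_T_aleph0.
pose code (o : option (seq nat)) := if o is Some l then (choice.pickle l).+1 else 0.
have code_inj : injective code.
  by move=> [l|] [m|] //= [] /(pcan_inj (@choice.pickleK _)) ->.
have touch o o' : o <> o' -> touching G (V (code o)) (V (code o')).
  move=> oo'; case: (ltngtP (code o) (code o')) => [lt|gt|/code_inj //].
    by have [_ [x [y [Vx Vy Exy]]]] := VV _ _ lt; exists y, x; split=> //; exact: adj_sym.
  by have [] := VV _ _ gt.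
exists (V \o code); split.
- by move=> o _; have [? ? ?] := VW (code o); split=> //; exact: conn_connected.
- move=> o o' _ _ [x [/= Vx V'x]]; apply: contrapT => oo'.
  case: (ltngtP (code o) (code o')) => [lt|gt|/code_inj //].
    by have [/(_ x V'x Vx)] := VV _ _ lt.
  by have [/(_ x Vx V'x)] := VV _ _ gt.
- move=> o o' Eoo'; apply: touch => oo'; rewrite oo' in Eoo'.
  exact: adj_irrefl Eoo'.
Qed.


(** By disjointness each vertex of [R] lies in at most one [N i]. *)
Lemma eventually_disjoint R (N : nat -> set T) : finite_set R ->
  (forall i j z, i < j -> N i z -> N j z -> False) ->
  exists m, forall i z, m <= i -> N i z -> R z -> False.
Proof.
move=> fR disj; elim/finite_set_ind: R / fR => [|x R fR _ [m mP]].
  by exists 0 => i z _ _ [].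
have [[k Nkx]|no] := pselect (exists k, N k x); last first.
  exists m => i z mi Nz [/= zx|]; last exact: mP mi Nz.
  by apply: no; exists i; rewrite -zx.
exists (maxn m k.+1) => i z; rewrite geq_max => /andP[mi ki] Nz [/= zx|];
  last exact: mP mi Nz.
by apply: (disj k i x) => //; rewrite -zx.
Qed.

(** A tree vertex needs an edge to [t], so [V] is extended by a finite link from [v] to just short
    of [U]; the shift by [m] discards all [N i] that meet the link. *)
Lemma split_config_touching (W : set T) u v U V N x n :
  iec G W -> split_config G W u v U V N x n ->
  exists V' m, touching G U V' /\
    split_config G W u v U V' (fun i => N (m + i)) (fun i => x (m + i)) (fun i => n (m
      + i)).
Proof.
move=> iW [sub subN cU Uu cV Vv UV Ux iN Nn adjn NUV NN].
have nUv : ~ U v by move=> Uv; exact: UV Uv Vv.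
have [||R [fR cR RW Rv [r [y [Rr Wy Uy Ery]]]]] := conn_exit (iec_conn iW) _ nUv (Y := U).
- by apply: sub; right.
- by exists u => //; apply: sub; left.
have [m mP] := eventually_disjoint fR NN.
exists (V `|` R), m; split.
  by exists y, r; split=> //; [right|exact: adj_sym].
constructor=> //.
- by move=> z [Uz|[Vz|/RW[]//]]; apply: sub; [left|right].
- by apply: connU => //; exists v, v; split=> //; left.
- by left.
- by move=> z Uz [/(UV _ Uz)|/RW[]].
- by move=> i; have [w Vw Ew] := adjn (m + i); exists w => //; left.
- move=> i z Nz [Uz|[Vz|]]; [|  |exact: mP (leq_addr _ _) Nz].
    by apply: NUV Nz _; left.
  by apply: NUV Nz _; right.
- by move=> i j z ij; apply: NN; rewrite ltn_add2l.
Qed.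

(* Iterating the splits yields a tree of branch sets [V]; the sets [U] hang
   together and form the branch set of [t]. *)
Lemma star_minor_of_splits (C : set T -> T -> T -> Prop) :
  (forall W u v, C W u v -> iec G W /\ W `<=` vset G) ->
  (forall W u v, C W u v -> exists U V N x n, split_config G W u v U V N x n /\
     forall i, C (N i `|` [set x i]) (x i) (n i)) ->
  (exists W u v, C W u v) -> has_T_aleph0_star_t_minor G.
Proof.
move=> Ciec Csplit [W0 [u0 [v0 C0]]].
pose node := {t : set T * T * T | C t.1.1 t.1.2 t.2}.
pose W (d : node) := (sval d).1.1; pose u (d : node) := (sval d).1.2.
(* The vertex [u] of a child lies in the set [U] of its parent; [body] leaves it out so that bodies
   of siblings are disjoint. *)
pose v (d : node) := (sval d).2; pose body d := W d `\ u d.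
have /choice[f fP] : forall d : node, exists s : set T * set T * (nat -> node),
    [/\ conn G s.1.1, conn G s.1.2, s.1.1 (u d), s.1.2 (v d) & touching G s.1.1 s.1.2] /\
    [/\ s.1.1 `<=` W d, s.1.2 `<=` body d, (forall z, s.1.1 z -> s.1.2 z -> False)
      & forall i j z, body (s.2 i) z -> body (s.2 j) z -> i = j] /\
    (forall i, [/\ s.1.1 (u (s.2 i)), body (s.2 i) `<=` body d,
      (forall z, body (s.2 i) z -> s.1.1 z \/ s.1.2 z -> False)
      & exists2 r, s.1.2 r & adj G (v (s.2 i)) r]).
  move=> [[[Wd ud] vd] /= Cd]; rewrite /body /W /u /v /=.
  have [iW WG] := Ciec _ _ _ Cd.
  have [U [V0 [N0 [x0 [n0 [sc0 C0']]]]]] := Csplit _ _ _ Cd.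
  have [V [m [tUV sc]]] := split_config_touching iW sc0.
  pose ch i : node := exist _ (N0 (m + i) `|` [set x0 (m + i)], x0 (m + i), n0 (m + i))
    (C0' (m + i)).
  have chE i z : (N0 (m + i) `|` [set x0 (m + i)]) z -> z <> x0 (m + i) -> N0 (m + i) z.
    by move=> [].
  case: sc => sub subN cU Uu cV Vv UV Ux iN Nn adjn NUV NN.
  exists (U, V, ch) => /=; split; [by split|split; [split=> //|]].
  - by move=> z Uz; apply: sub; left.
  - move=> z Vz; split; first by apply: sub; right.
    by move=> /= zu; apply: UV Vz; rewrite zu.
  - move=> i j z [/chE Niz /Niz{}Niz] [/chE Njz /Njz{}Njz].
    by case: (ltngtP i j) => // ij; [case: (NN i j z ij)|case: (NN j i z ij)].
  - move=> i; split=> //.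
    + move=> z [/chE Nz /Nz{}Nz]; split; first exact: subN Nz.
      by move=> /= zu; apply: (NUV i z Nz); left; rewrite zu.
    + by move=> z [/chE Nz /Nz{}Nz] ?; apply: (NUV i z Nz).
pose U d := (f d).1.1; pose V d := (f d).1.2; pose ch d := (f d).2.
have cU d : conn G (U d) by have [[]] := fP d.
have cV d : conn G (V d) by have [[]] := fP d.
have Uu d : U d (u d) by have [[]] := fP d.
have Vv d : V d (v d) by have [[]] := fP d.
have tUV d : touching G (U d) (V d) by have [[]] := fP d.
have UW d : U d `<=` W d by have [_ [[]]] := fP d.
have Vbody d : V d `<=` body d by have [_ [[]]] := fP d.
have UV d z : U d z -> V d z -> False by have [_ [[_ _ h _] _]] := fP d; exact: h.
have ch_inj d i j z : body (ch d i) z -> body (ch d j) z -> i = j.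
  by have [_ [[_ _ _ h] _]] := fP d; exact: h.
have Uch d i : U d (u (ch d i)) by have [_ [_ /(_ i)[]]] := fP d.
have ch_body d i : body (ch d i) `<=` body d by have [_ [_ /(_ i)[]]] := fP d.
have ch_UV d i z : body (ch d i) z -> U d z \/ V d z -> False.
  by have [_ [_ /(_ i)[_ _ h _]]] := fP d; exact: h.
have ch_adj d i : exists2 r, V d r & adj G (v (ch d i)) r by have [_ [_ /(_ i)[]]] :=
  fP d.
pose d0 : node := exist _ (W0, u0, v0) C0.
pose nd := fix nd (l : seq nat) := if l is i :: l' then ch (nd l') i else d0.
have body_cat m l : body (nd (m ++ l)) `<=` body (nd l).
  by elim: m => [|i m IHm] //= z /ch_body; exact: IHm.
(* Bodies shrink away from the root and a child's body avoids the [U] and [V] of its parent, so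
   below a vertex of [body (nd l)] can only be used at an extension of [l]. *)
have suffix_of l l' z : body (nd l) z -> body (nd l') z ->
    U (nd l') z \/ V (nd l') z -> exists m, l' = m ++ l.
  elim: l => [|i l IHl] bz b'z UVz; first by exists l'; rewrite cats0.
  have [m E] := IHl (ch_body _ _ _ bz) b'z UVz.
  case/lastP: m E => [|m j] E; first by subst; case: (ch_UV _ _ _ bz UVz).
  move: E; rewrite cat_rcons => E; exists m; rewrite E.
  by have -> : i = j by apply: ch_inj bz _; rewrite E in b'z; exact: body_cat b'z.
have node_eq l l' z : body (nd l) z -> body (nd l') z ->
    U (nd l) z \/ V (nd l) z -> U (nd l') z \/ V (nd l') z -> l = l'.
  move=> bz b'z h h'; have [m E] := suffix_of _ _ _ bz b'z h'.
  have [m' E'] := suffix_of _ _ _ b'z bz h.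
  have : size l' <= size l by rewrite E' size_cat leq_addl.
  by rewrite E size_cat -{2}[size l]add0n leq_add2r leqn0 => /nilP ->.
(* A vertex of [U (nd l')] other than [u (nd l')] is in the body, where [node_eq] applies;
   [u (nd l')] itself lies in the [U] of the parent, and at the root in no body. *)
have UV_disj l l' z : U (nd l') z -> V (nd l) z -> False.
  elim: l' z => [|i l' IHl'] z Uz Vz; have bz := Vbody _ _ Vz.
    have [zu|zu] := pselect (z = u d0).
      by have := body_cat l [::] z; rewrite cats0 => /(_ bz)[_]; apply.
    have E : l = [::] by apply: (node_eq _ _ z) => //; [split=> //; exact: UW|right|left].
    by rewrite E in Vz; exact: UV Uz Vz.
  have [zu|zu] := pselect (z = u (nd (i :: l'))).
    by apply: (IHl' z) => //; rewrite zu; exact: Uch.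
  have E : l = i :: l' by apply: (node_eq _ _ z) => //; [split=> //;
    exact: UW|right|left].
  by rewrite E in Vz; exact: UV Uz Vz.
pose hub := \bigcup_l U (nd l).
have hub_conn : conn G hub.
  (* A trunk joins the sets [U] from [l] to the root, consecutive ones sharing the [u] of the lower
     node; all trunks contain [u d0]. *)
  pose trunk := fix trunk l :=
    if l is i :: l' then U (nd (i :: l')) `|` trunk l' else U (nd [::]).
  have U_trunk l : U (nd l) `<=` trunk l by case: l => [|i l] z //; left.
  have -> : hub = \bigcup_l trunk l.
    rewrite predeqE => z; split=> [[l _ Uz]|[l _]]; first by exists l => //;
      exact: U_trunk.
    elim: l => [Uz|i l IHl]; first by exists [::].
    by move=> [Uz|/IHl//]; exists (i :: l).
  apply: (@conn_bigU _ _ _ _ _ (u d0)) => l _; elim: l => [|i l [ct tu]]; first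
    by split; [exact: cU|exact: Uu].
  split; last by right.
  apply: connU => //.
  exists (u (nd (i :: l))), (u (nd (i :: l))); split; [exact: Uu| |by left].
  by apply: U_trunk; exact: Uch.
have WG d : W d `<=` vset G by case: d => [[[Wd ud] vd] /= Cd]; have [] := Ciec _ _ _ Cd.
exists (seq nat), seq_tree; split; first exact: seq_tree_T_aleph0.
exists (fun o => if o is Some l then V (nd l) else hub); split.
- move=> [l|] _; split; rewrite ?/hub.
  + by move=> z /Vbody[/WG].
  + by exists (v (nd l)).
  + exact: conn_connected.
  + by move=> z [l _ /UW/WG].
  + by exists (u d0), [::] => //; exact: Uu.
  + exact: conn_connected.
- move=> [l|] [l'|] _ _ [z []] //=.
  + move=> Vz V'z; congr Some; apply: (node_eq _ _ z);
      [exact: Vbody|exact: Vbody|by right|by right].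
  + by move=> Vz [l' _ Uz]; case: (UV_disj _ _ _ Uz Vz).
  + by move=> [l _ Uz] Vz; case: (UV_disj _ _ _ Uz Vz).
- move=> [l|] [l'|] //=.
  + case=> -[i ->] /=.
      by have [r Vr Er] := ch_adj (nd l) i; exists r, (v (ch (nd l) i)); split=> //;
        exact: adj_sym.
    by have [r Vr Er] := ch_adj (nd l') i; exists (v (ch (nd l') i)), r; split.
  + move=> _; have [a [b [Ua Vb Eab]]] := tUV (nd l).
    by exists b, a; split=> //; [exists l|exact: adj_sym].
  + move=> _; have [a [b [Ua Vb Eab]]] := tUV (nd l').
    by exists a, b; split=> //; exists l'.
Qed.

End Minors.

(** * From set configurations to plow minors *)

Section Quotients.
Context {T : Type} (G : sgraph T).

Lemma iec_of_infinitely_edge_connected :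
  infinitely_edge_connected G -> iec G (vset G).
Proof.
move=> hG P [x Vx Px] [y Vy nPy] fin.
have xy : x <> y by move=> xy; apply: nPy; rewrite -xy.
have fF := finite_image (fun e : T * T => [set e.1; e.2]) fin.
set F := (X in finite_set X) in fF.
have joinedF : joined (delete_edges G F) x y.
  by apply: hG => // _ [[a b] [/= _ _ Eab] <-]; exists a, b.
suff inv a b : joined (delete_edges G F) a b -> P a -> P b
  by exact: nPy (inv _ _ joinedF Px).
elim=> {a b} [a b [Eab nF] Pa|//|a b c _ IH1 _ IH2 /IH1/IH2//].
apply: contrapT => nPb; apply: nF; exists (a, b) => //; split=> //=.
  by split=> //; exact: adj_vset Eab.
by split=> //; apply: adj_vset (adj_sym Eab).
Qed.

Variables (g : T -> T) (A : set T).

Definition quotient_adj (p q : T) : Prop :=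
  p <> q /\ exists x y, [/\ A x, A y, g x = p, g y = q & adj G x y].

Let quotient_sym p q : quotient_adj p q -> quotient_adj q p.
Proof.
move=> [pq [x [y [Ax Ay xp yq Exy]]]]; split; first exact: nesym.
by exists y, x; split=> //; exact: adj_sym.
Qed.

Let quotient_irrefl p : ~ quotient_adj p p.
Proof. by move=> []. Qed.

Let quotient_vset p q : quotient_adj p q -> (g @` A) p.
Proof. by move=> [_ [x [y [Ax _ xp _ _]]]]; exists x. Qed.

Definition quotient : sgraph T := SGraph quotient_sym quotient_irrefl quotient_vset.

(* Finite fibres keep the preimage of a finite set of edges finite. *)
Lemma quotient_infinitely_edge_connected (Z : set T) :
  finite_set Z -> (forall x, A x -> ~ Z x -> g x = x) -> iec G A ->
  infinitely_edge_connected quotient.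
Proof.
move=> fZ gZ iA _ _ [x Ax <-] [y Ay <-] _ F fF FE; apply: contrapT => nxy.
pose P z := joined (delete_edges quotient F) (g x) (g z).
have fibre p : finite_set (A `&` [set z | g z = p]).
  apply: sub_finite_set (finite_setU2 fZ (finite_set1 p)) => z [Az /= zp].
  by have [Zz|nZz] := pselect (Z z); [left|right; rewrite /= -zp gZ].
have fpre e : F e -> finite_set (A `&` [set z | e (g z)]).
  move=> /FE[p [q [_ ->]]]; apply: sub_finite_set (finite_setU2 (fibre p) (fibre q)).
  by move=> z [Az [zp|zq]]; [left|right].
apply: (iA P); [by exists x => //; exact: rt_refl|by exists y|].
have : finite_set (\bigcup_(e in F) ((A `&` [set z | e (g z)]) `*` (A `&` [set z | e (g
  z)]))).
  by apply: bigcup_finite => // e /fpre ?; exact: finite_setX.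
apply: sub_finite_set => -[a b] [/= [Aa Pa] [Ab nPb] Eab].
have gab : g a <> g b by move=> gab; apply: nPb; rewrite /P -gab.
have Fab : F [set g a; g b].
  apply: contrapT => nF; apply: nPb; apply: rt_trans Pa _; apply: rt_step.
  by split=> //; split=> //; exists a, b.
by exists [set g a; g b] => //; split; split=> //=; [left|right].
Qed.

End Quotients.

Section PlowMinor.
Context {T : Type} (G : sgraph T).

(** The minor contracts [U] with a link [R1] to [a], [V] with a link [R2] to [b], and [l] into [k].
    The links end next to [k] and [l], which creates the edges to the head that half-plows
    require. *)
Lemma plow_minor_of_set_plow u v :
  set_plow G (vset G) u v -> has_plow_minor_connecting G u v.
Proof.
move=> [A1 [A2 [U [V [k [l [a [b pc]]]]]]]].
case: pc => i1 i2 sub A1k A1a ak A2l A2b bl meet hd cU Uu Ua cV Vv Vb UV hU hV.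
have [|R1 [fR1 cR1 R1A R1a [r1 [_ [R1r _ -> Er1]]]]] :=
    conn_exit (Y := [set k]) (iec_conn i1) A1a ak; first by exists k.
have [|R2 [fR2 cR2 R2A R2b [r2 [_ [R2r _ -> Er2]]]]] :=
    conn_exit (Y := [set l]) (iec_conn i2) A2b bl; first by exists l.
have nA2a : ~ A2 a by move=> /(meet _ A1a)[].
have nA1b : ~ A1 b by move=> A1b; have [_] := meet _ A1b A2b.
have ab : a <> b by move=> ab; apply: nA1b; rewrite -ab.
have bk : b <> k by move=> bk; apply: nA1b; rewrite bk.
have al : a <> l by move=> al; apply: nA2a; rewrite al.
pose Ba := R1 `|` U; pose Bb := R2 `|` V.
have R1A1 z : R1 z -> A1 z by move=> /R1A[].
have R2A2 z : R2 z -> A2 z by move=> /R2A[].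
have Bak z : Ba z -> z <> k.
  by move=> [/R1A[]//|Uz] zk; apply: ak; rewrite -(hU z Uz) //; left; rewrite zk.
have Bbl z : Bb z -> z <> l.
  by move=> [/R2A[]//|Vz] zl; apply: bl; rewrite -(hV z Vz) //; right; rewrite zl.
have BaA2 z : Ba z -> A2 z -> False.
  move=> Bz A2z; have [R1z|Uz] := Bz.
    by have [zk _] := meet z (R1A1 z R1z) A2z; exact: Bak zk.
  by apply: nA2a; rewrite -(hU z Uz) //; right.
have BbA1 z : Bb z -> A1 z -> False.
  move=> Bz A1z; have [R2z|Vz] := Bz.
    by have [_ zl] := meet z A1z (R2A2 z R2z); exact: Bbl zl.
  by apply: nA1b; rewrite -(hV z Vz) //; left.
have Bab z : Ba z -> Bb z -> False.
  move=> Baz Bbz; have [R1z|Uz] := Baz; first exact: BbA1 Bbz (R1A1 z R1z).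
  have [R2z|Vz] := Bbz; first exact: BaA2 Baz (R2A2 z R2z).
  exact: UV Uz Vz.
pose g z := if pselect (Ba z) then a else if pselect (Bb z) then b
            else if pselect (z = l) then k else z.
have ga z : Ba z -> g z = a by rewrite /g; case: pselect.
have gb z : Bb z -> g z = b.
  by move=> Bz; rewrite /g; case: pselect => [Az|nAz];
    [case: (Bab _ Az Bz)|case: pselect].
have gl : g l = k.
  rewrite /g; case: pselect => [Bl|nBl]; first by case: (BaA2 _ Bl A2l).
  by case: pselect => [Bl|nBl2]; [case: (Bbl _ Bl)|case: pselect].
have gid z : ~ Ba z -> ~ Bb z -> z <> l -> g z = z.
  by move=> *; rewrite /g; do 3 case: pselect => //.
have gk : g k = k.
  have [kl|kl] := pselect (k = l); first by rewrite {1}kl.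
  by apply: gid => // Bk; [case: (Bak k)|case: (BbA1 k)].
have BaRa : Ba a by right.
have BbRb : Bb b by right.
pose H1 := quotient G g A1; pose H2 := quotient G g A2.
(* [U] and [V] may be infinite, but they meet [A1] and [A2] only in [a] and [b], so [g] moves
   finitely many vertices of these sets. *)
have fin : finite_set (R1 `|` R2 `|` [set l; a; b]).
  by apply: finite_setU2; [exact: finite_setU2|exact: finite_set3].
have g1 z : A1 z -> ~ (R1 `|` R2 `|` [set l; a; b]) z -> g z = z.
  move=> A1z nz; apply: gid.
  - move=> [R1z|Uz]; apply: nz; first by left; left.
    by right; left; right; apply: hU => //; left.
  - by move=> Bz; exact: BbA1 Bz A1z.
  - by move=> zl; apply: nz; right; left; left.
have g2 z : A2 z -> ~ (R1 `|` R2 `|` [set l; a; b]) z -> g z = z.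
  move=> A2z nz; apply: gid.
  - by move=> Bz; exact: BaA2 Bz A2z.
  - move=> [R2z|Vz]; apply: nz; first by left; right.
    by right; right; apply: hV => //; right.
  - by move=> zl; apply: nz; right; left; left.
have gA1 z : A1 z -> A1 (g z).
  move=> A1z; have [Bz|nBz] := pselect (Ba z); first by rewrite ga.
  have [->|zl] := pselect (z = l); first by rewrite gl.
  by rewrite gid // => Bz; exact: BbA1 Bz A1z.
have gA2 z : A2 z -> A2 (g z) \/ g z = k.
  move=> A2z; have [Bz|nBz] := pselect (Bb z); first by rewrite gb //; left.
  have [->|zl] := pselect (z = l); first by rewrite gl; right.
  by left; rewrite gid // => Bz; exact: BaA2 Bz A2z.
pose B p := [set z | g z = p] `&` (A1 `|` A2 `|` U `|` V).
have Bin z : A1 z \/ A2 z -> B (g z) z.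
  by move=> h; split=> //; left; left.
have BE p : B p !=set0 -> conn G (B p).
  move=> [z0 [z0p z0in]].
  have [pa|pa] := pselect (p = a).
    have -> : B p = Ba.
      rewrite pa predeqE => z; split=> [[/= gz _]|Bz]; last first.
        by split; [exact: ga|case: Bz => [/R1A1 ?|?]; [left; left; left|left; right]].
      apply: contrapT => nBz; have [Bz|nBbz] := pselect (Bb z).
        by apply: ab; rewrite -gz gb.
      have [zl|zl] := pselect (z = l); first by apply: ak; rewrite -gz zl gl.
      by move: gz; rewrite gid // => zE; apply: nBz; rewrite zE.
    by apply: connU => //; exists a, a; split=> //; left.
  have [pb|pb] := pselect (p = b).
    have -> : B p = Bb.
      rewrite pb predeqE => z; split=> [[/= gz _]|Bz]; last first.
        by split; [exact: gb|case: Bz => [/R2A2 ?|?]; [left; left; right|right]].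
      apply: contrapT => nBz; have [Bz|nBaz] := pselect (Ba z).
        by apply: ab; rewrite -gz ga.
      have [zl|zl] := pselect (z = l); first by apply: bk; rewrite -gz zl gl.
      by move: gz; rewrite gid // => zE; apply: nBz; rewrite zE.
    by apply: connU => //; exists b, b; split=> //; left.
  have [pk|pk] := pselect (p = k).
    have -> : B p = [set k] `|` [set l].
      rewrite pk predeqE => z; split=> [[/= gz _]|[/= ->|/= ->]].
      - have [Bz|nBaz] := pselect (Ba z); first by case: ak; rewrite -gz ga.
        have [Bz|nBbz] := pselect (Bb z); first by case: bk; rewrite -gz gb.
        have [zl|zl] := pselect (z = l); first by right.
        by left; move: gz; rewrite gid.
      - by split=> //; left; left; left.
      - by split=> //; left; left; right.
    by apply: connU; [exact: conn1|exact: conn1|exists k, l].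
  have -> : B p = [set p]; last exact: conn1.
  have single z : g z = p -> z = p.
    move=> gz; have [Bz|nBaz] := pselect (Ba z); first by case: pa; rewrite -gz ga.
    have [Bz|nBbz] := pselect (Bb z); first by case: pb; rewrite -gz gb.
    have [zl|zl] := pselect (z = l); first by case: pk; rewrite -gz zl gl.
    by move: gz; rewrite gid.
  rewrite predeqE => z; split=> [[/= /single]//|/= ->].
  by have := single _ z0p => z0E; split; rewrite -z0E //= z0p.
have B_ne p : (g @` A1 `|` g @` A2) p -> B p !=set0.
  by move=> [] [z Az <-]; exists z; apply: Bin; [left|right].
exists T, (graph_union H1 H2), a, b, k, B; split.
- exists H1, H2; split=> //.
  + split; first exact: quotient_infinitely_edge_connected fin g1 i1.
    split=> //; exists r1, k; split=> //; [exact: R1A1|by apply: ga; left].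
  + split; first exact: quotient_infinitely_edge_connected fin g2 i2.
    split; first exact: nesym.
    by exists l, r2; split=> //; [exact: R2A2|by apply: gb; left|exact: adj_sym].
  + rewrite predeqE => p; split=> [[[x A1x xp] [y A2y yp]]|/= ->].
      have A1p : A1 p by rewrite -xp; exact: gA1.
      by case: (gA2 y A2y); rewrite yp // => A2p; have [] := meet p A1p A2p.
    by split; [exists k|exists l].
- split.
  + move=> p Pp; have ne := B_ne p Pp; split=> //; last exact/conn_connected/BE.
    by move=> z [_ /sub].
  + by move=> p q _ _ [z [[/= <- _] [/= <- _]]].
  + move=> p q [] [_ [x [y [Ax Ay <- <- Exy]]]]; exists x, y.
      by split=> //; apply: Bin; left.
    by split=> //; apply: Bin; right.
- left; split; split.
  + by apply: ga; right.
  + by left; right.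
  + by apply: gb; right.
  + by right.
Qed.

End PlowMinor.

(** * From a child of a split back to its parent *)

Section Children.
Context {T : Type} (G : sgraph T).
Variables (W : set T) (u v : T) (U V : set T) (N : nat -> set T) (x n : nat -> T).
Hypothesis sc : split_config G W u v U V N x n.

Let NxW i : N i `|` [set x i] `<=` W.
Proof.
move=> z [/(sc_subN sc)//|/= ->].
by apply: (sc_sub sc); left; exact: (sc_Ux sc i).
Qed.

Let NxU i z : (N i `|` [set x i]) z -> U z -> z = x i.
Proof. by move=> [Nz Uz|//]; case: (sc_NUV sc (i := i) Nz); left. Qed.

Let NxV i z : (N i `|` [set x i]) z -> V z -> False.
Proof.
move=> [Nz Vz|/= -> Vx]; first by apply: (sc_NUV sc (i := i) Nz); right.
exact: (sc_UV sc (sc_Ux sc i) Vx).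
Qed.

(** [U] joins [u] to [x i] and [V] joins [v] to a neighbour of [n i], so the child's connecting sets
    can be prolonged; [U] meets the child only in [x i], [V] not at all. *)
Lemma set_plow_child i :
  set_plow G (N i `|` [set x i]) (x i) (n i) -> set_plow G W u v.
Proof.
move=> [A1 [A2 [U1 [V1 [k [l [a [b pc]]]]]]]].
case: pc => i1 i2 sub A1k A1a ak A2l A2b bl meet hd cU Uu Ua cV Vv Vb UV hU hV.
have AN z : A1 z \/ A2 z -> (N i `|` [set x i]) z.
  by move=> Az; apply: sub; left; left.
have UN z : U1 z -> (N i `|` [set x i]) z by move=> Uz; apply: sub; left; right.
have VN z : V1 z -> (N i `|` [set x i]) z by move=> Vz; apply: sub; right.
exists A1, A2, (U `|` U1), (V `|` V1), k, l, a, b; constructor=> //.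
- move=> z [[Az|[Uz|/UN/NxW//]]|[Vz|/VN/NxW//]].
  + exact/NxW/AN.
  + by apply: (sc_sub sc); left.
  + by apply: (sc_sub sc); right.
- by apply: connU => //; [exact: (sc_connU sc)|exists (x i), (x i); split=> //;
    [exact: (sc_Ux sc i)|left]].
- by left; exact: (sc_Uu sc).
- by right.
- apply: connU => //; first exact: (sc_connV sc).
  by have [r Vr Er] := sc_adj sc i; exists r, (n i); split=> //; right; exact: adj_sym.
- by left; exact: (sc_Vv sc).
- by right.
- move=> z [Uz|U1z] [Vz|V1z].
  + exact: (sc_UV sc Uz Vz).
  + by have zx := NxU (VN z V1z) Uz; apply: (UV (x i)) => //; rewrite -zx.
  + exact: (NxV (UN z U1z) Vz).
  + exact: (UV z U1z V1z).
- move=> z [Uz|U1z] Az; last exact: hU.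
  by have zx := NxU (AN z Az) Uz; apply: hU => //; rewrite zx.
- move=> z [Vz|V1z] Az; last exact: hV.
  by case: (NxV (AN z Az) Vz).
Qed.

(** A child's split at [n i] is prolonged through [V] to [v], and its other side through [U] to [u].
    Hence a parent that does not split at [v] passes this on to its children. *)
Lemma splits_child i :
  splits G (N i `|` [set x i]) (n i) (x i) -> splits G W v u.
Proof.
move=> [U1 [V1 [N1 [x1 [n1 sc1]]]]].
have UN z : U1 z -> (N i `|` [set x i]) z by move=> Uz; apply: (sc_sub sc1); left.
have VN z : V1 z -> (N i `|` [set x i]) z by move=> Vz; apply: (sc_sub sc1); right.
exists (V `|` U1), (U `|` V1), N1, x1, n1; constructor.
- move=> z [[Vz|/UN/NxW//]|[Uz|/VN/NxW//]]; first by apply: (sc_sub sc); right.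
  by apply: (sc_sub sc); left.
- by move=> j z /(sc_subN sc1)/NxW.
- apply: connU; [exact: (sc_connV sc)|exact: (sc_connU sc1)|].
  have [r Vr Er] := sc_adj sc i; exists r, (n i); split=> //; first exact: (sc_Uu sc1).
  by right; exact: adj_sym.
- by left; exact: (sc_Vv sc).
- apply: connU; [exact: (sc_connU sc)|exact: (sc_connV sc1)|].
  exists (x i), (x i); split; [exact: (sc_Ux sc i)|exact: (sc_Vv sc1)|by left].
- by left; exact: (sc_Uu sc).
- move=> z [Vz|U1z] [Uz|V1z].
  + exact: (sc_UV sc Uz Vz).
  + exact: (NxV (VN z V1z) Vz).
  + have zx := NxU (UN z U1z) Uz; apply: (sc_UV sc1) U1z _; rewrite zx.
    exact: (sc_Vv sc1).
  + exact: (sc_UV sc1 U1z V1z).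
- by move=> j; right; exact: (sc_Ux sc1 j).
- exact: (sc_iec sc1).
- exact: (sc_n sc1).
- by move=> j; have [r Vr Er] := sc_adj sc1 j; exists r => //; right.
- move=> j z Nz; have NN := sc_subN sc1 Nz; have dis := sc_NUV sc1 Nz.
  move=> [[Vz|U1z]|[Uz|V1z]]; [exact: (NxV NN Vz)|by apply: dis; left| |by apply: dis;
    right].
  by apply: dis; right; rewrite (NxU NN Uz); exact: (sc_Vv sc1).
- exact: (sc_N sc1).
Qed.

End Children.

Theorem theorem6p5 (T : Type) (G : sgraph T) (u v : T)
    (hG : infinitely_edge_connected G)
    (hu : vset G u) (hv : vset G v) (huv : u <> v) :
  has_T_aleph0_star_t_minor G \/ has_plow_minor_connecting G u v.
Proof.
have iG := iec_of_infinitely_edge_connected hG.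
have [p|nplow] := pselect (set_plow G (vset G) u v).
  by right; exact: plow_minor_of_set_plow.
left; have [cm|ncm] := pselect (complete_minor G (vset G)).
  exact: star_minor_of_complete_minor.
pose C W x y := [/\ iec G W, W `<=` vset G, [/\ W x, W y & x <> y] & ~ set_plow G W x y].
have CC W x y : C W x y -> C W y x.
  by move=> [iW WG [Wx Wy xy] np]; split=> //; [split=> //; exact: nesym|by move=> p;
    apply: np; exact: set_plowC].
have Ciec W x y : C W x y -> iec G W /\ W `<=` vset G by move=> [].
have C0 : C (vset G) u v by split.
have dich W x y : C W x y -> splits G W x y \/ splits G W y x.
  move=> [iW WG [Wx Wy xy] np].
  have [//|s|s|cm] := plow_split_or_complete_minor iW Wx Wy xy; [by left|by right|].
  by case: ncm; exact: complete_minorS cm.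
have child W x y U V N xs ns i : C W x y -> split_config G W x y U V N xs ns ->
    C (N i `|` [set xs i]) (xs i) (ns i).
  move=> [_ WG _ np] sc.
  have NW : N i `|` [set xs i] `<=` W.
    by move=> z [/(sc_subN sc)//|/= ->]; apply: (sc_sub sc); left; exact: sc_Ux sc i.
  split; [exact: sc_iec sc i|exact: subset_trans WG| |by move=> p; apply: np;
    exact: set_plow_child sc _ p].
  split; [by right|by left; exact: sc_n sc i|move=> xn].
  by apply: (sc_NUV sc (sc_n sc i)); left; rewrite -xn; exact: sc_Ux sc i.
have [[W [x [y [Cxy nsp]]]]|all] :=
    pselect (exists W x y, C W x y /\ ~ splits G W y x).
  (* A triple that does not split at its second end splits at its first, and [splits_child] hands
     this property on to all children. *)
  apply: (@star_minor_of_splits _ _ (fun W x y => C W x y /\ ~ splits G W y x)).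
  - by move=> W' x' y' [/Ciec].
  - move=> W' x' y' [C' ns].
    have [[U [V [N [xs [ns' sc]]]]]|//] := dich _ _ _ C'.
    exists U, V, N, xs, ns'; split=> // i; split; first exact: child C' sc.
    by move=> s; apply: ns; exact: splits_child sc _ s.
  - by exists W, x, y.
(* Otherwise every triple in [C] splits at its second end, and by the symmetry [CC] also at its
   first. *)
apply: (star_minor_of_splits Ciec); last by exists (vset G), u, v.
move=> W x y Cxy; have [U [V [N [xs [ns sc]]]]] : splits G W x y.
  apply: contrapT => nsp; apply: all; exists W, y, x; split=> //.
  exact: CC.
by exists U, V, N, xs, ns; split=> // i; exact: child Cxy sc.
Qed.
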